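(* Let $d\ge 2$ and let $P\subset\mathbb{H}^d$ be a compact right-angled polyhedron. Let $\Gamma_P$ be the group generated by the reflections in the codimension 1 faces of $P$. Then $\Gamma_P$ admits ergodic invariant random subgroups which are faithful and spanning (i.e. there exists an ergodic invariant random subgroup of $\Gamma_P$ which is both faithful and spanning).
   Context: $\mathbb{H}^d$ is hyperbolic $d$-space. A right-angled polyhedron is a convex polyhedron (with nonempty interior) in $\mathbb{H}^d$ such that any two adjacent codimension 1 faces meet at dihedral angle $\pi/2$. For a countable discrete group $\Gamma$, let $\mathrm{Sub}_\Gamma$ be the space of subgroups of $\Gamma$ with the Chabauty topology (induced from the product topology on $\{0,1\}^\Gamma$); $\Gamma$ acts on it by conjugation. An invariant random subgroup (IRS) of $\Gamma$ is a Borel probability measure on $\mathrm{Sub}_\Gamma$ which is invariant under conjugation by elements of $\Gamma$. It is ergodic if every conjugation-invariant Borel subset of $\mathrm{Sub}_\Gamma$ has measure $0$ or $1$. Let $\mu$ be an IRS of $\Gamma$ and write $H$ for a $\mu$-random subgroup. The kernel of $\mu$ is $K_\mu=\{x\in\Gamma : \mathbb{P}_\mu(x\in H)=1\}$; the IRS $\mu$ is faithful if $K_\mu=\{1\}$, i.e. $\mathbb{P}_\mu(g\notin H)>0$ for all $g\in\Gamma\setminus\{1\}$. The normal envelope of $\mu$ is $E_\mu=\langle x\in\Gamma : \mathbb{P}_\mu(x\in H)>0\rangle$ (the smallest normal subgroup containing $\mu$-almost every subgroup); the IRS $\mu$ is spanning if $E_\mu=\Gamma$. *)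

(* Defs.v *)
From HB Require Import structures.
From mathcomp Require Import all_boot all_order all_algebra.
From mathcomp Require Import all_classical all_reals all_analysis.
From mathcomp Require Import ring lra.

Set Implicit Arguments.
Unset Strict Implicit.
Unset Printing Implicit Defensive.

Import Order.TTheory GRing.Theory Num.Theory.
Import numFieldNormedType.Exports.

Local Open Scope classical_set_scope.
Local Open Scope ring_scope.

Section Subgroups.
Variable G : groupType.
Local Open Scope group_scope.

Definition is_subgroup (H : set G) : Prop :=
  H 1 /\ forall x y, H x -> H y -> H (x * y^-1).

Definition generated_by (S : set G) : set G :=
  \bigcap_(H in [set H : set G | is_subgroup H /\ S `<=` H]) H.

Lemma generated_by_subgroup (S : set G) : is_subgroup (generated_by S).
Proof.
split=> [H [[]]//|x y Sx Sy H [sH SH]].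
by apply: sH.2; [exact: Sx|exact: Sy].
Qed.

(* The ambient space {0,1}^G carries the product topology, and the subtype
   [SubGrp] the induced one. *)
Definition subgroup_set : set {ptws G -> bool} :=
  [set h | is_subgroup [set x | h x]].

Definition SubGrp : Type := set_type subgroup_set.

HB.instance Definition _ := Topological.on SubGrp.

Definition in_sub (x : G) (H : SubGrp) : bool := set_val H x.

Lemma sub_trivial_subproof : subgroup_set (fun x : G => x == 1).
Proof.
by split=> [/=|x y /= /eqP -> /eqP ->]; rewrite ?eqxx// invg1 mulg1.
Qed.

Definition sub_trivial : SubGrp :=
  exist _ (fun x : G => x == 1) (mem_set sub_trivial_subproof).

HB.instance Definition _ := isPointed.Build SubGrp sub_trivial.

Lemma sub_conj_subproof (g : G) (H : SubGrp) :
  subgroup_set (fun x => in_sub (x ^ g) H).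
Proof.
have [H1 HM] : subgroup_set (set_val H) by exact: set_valP.
split=> [|x y /= Hx Hy]; rewrite /in_sub /=; first by rewrite conj1g.
by rewrite conjMg conjVg; exact: HM.
Qed.

(* In MathComp [x ^ g] is [g^-1 * x * g], so this is the subgroup g H g^-1. *)
Definition sub_conj (g : G) (H : SubGrp) : SubGrp :=
  exist _ (fun x => in_sub (x ^ g) H) (mem_set (sub_conj_subproof g H)).

Definition borelSubGrp := g_sigma_algebraType (@open SubGrp).

HB.instance Definition _ := Measurable.on borelSubGrp.

End Subgroups.

Arguments in_sub {G} x H.
Arguments sub_conj {G} g H.

Section IRS.
Variables (R : realType) (G : groupType).
Implicit Type mu : probability (borelSubGrp G) R.

Definition is_IRS mu : Prop :=
  forall (g : G) (B : set (borelSubGrp G)),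
    measurable B -> mu (sub_conj g @^-1` B) = mu B.

Definition irs_ergodic mu : Prop :=
  forall B : set (borelSubGrp G), measurable B ->
    (forall g : G, sub_conj g @^-1` B = B) -> mu B = 0%E \/ mu B = 1%E.

Definition irs_kernel mu : set G :=
  [set x | mu [set H | in_sub x H] = 1%E].

Definition irs_faithful mu : Prop := irs_kernel mu = [set 1%g].

Definition irs_envelope mu : set G :=
  generated_by [set x | (0 < mu [set H | in_sub x H])%E].

Definition irs_spanning mu : Prop := irs_envelope mu = setT.

End IRS.

Section Hyperbolic.
Variables (R : realType) (d : nat).
Implicit Types (x y u v : 'cV[R]_d.+1) (A : 'M[R]_d.+1).

(* The Lorentz form of signature (d,1); coordinate 0 is the time-like one. *)
Definition lor x y : R :=
  \sum_(i < d) x (lift ord0 i) 0 * y (lift ord0 i) 0 - x 0 0 * y 0 0.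

Definition hyperboloid : set 'cV[R]_d.+1 :=
  [set x | lor x x = -1 /\ 0 < x 0 0].

(* [set_type] carries the topology induced from R^(d+1), which is also that of
   the hyperbolic metric, cosh (dist x y) = - lor x y. *)
Definition hspace : Type := set_type hyperboloid.

HB.instance Definition _ := Topological.on hspace.

(* Isom(H^d) is the group O^+(d,1) of positive Lorentz matrices, acting on
   column vectors on the left. *)
Definition positive_lorentz A : bool :=
  `[< (forall x y, lor (A *m x) (A *m y) = lor x y) /\
      (forall x, hyperboloid x -> hyperboloid (A *m x)) >].

Definition hisom : Type := {A : 'M[R]_d.+1 | positive_lorentz A}.

HB.instance Definition _ := Choice.on hisom.

Lemma lorC x y : lor x y = lor y x.
Proof. by rewrite /lor mulrC; congr (_ - _); apply: eq_bigr => i _; ring. Qed.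

Lemma lorDl x y z : lor (x + y) z = lor x z + lor y z.
Proof.
rewrite /lor !mxE (eq_bigr (fun i => x (lift ord0 i) 0 * z (lift ord0 i) 0 +
  y (lift ord0 i) 0 * z (lift ord0 i) 0)); last by move=> i _; rewrite !mxE; ring.
by rewrite big_split/=; ring.
Qed.

Lemma lorZl a x y : lor (a *: x) y = a * lor x y.
Proof.
rewrite /lor !mxE mulrBr mulr_sumr mulrA; congr (_ - _).
by apply: eq_bigr => i _; rewrite !mxE; ring.
Qed.

Lemma lorDr x y z : lor z (x + y) = lor z x + lor z y.
Proof. by rewrite lorC lorDl !(lorC z). Qed.

Lemma lorZr a x y : lor y (a *: x) = a * lor y x.
Proof. by rewrite lorC lorZl lorC. Qed.

Lemma lorNN x : lor (- x) (- x) = lor x x.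
Proof. by rewrite -scaleN1r lorZl lorZr; ring. Qed.

Lemma lor_nondegenerate x : (forall y, lor x y = 0) -> x = 0.
Proof.
move=> /(_ (\col_i (if i == 0 then - x i 0 else x i 0))).
rewrite /lor !mxE eqxx (eq_bigr (fun i : 'I_d => x (lift ord0 i) 0 ^+ 2)); last first.
  by move=> i _; rewrite !mxE.
rewrite mulrN opprK => /eqP.
rewrite paddr_eq0 ?sumr_ge0//; last by rewrite -expr2 sqr_ge0.
  rewrite psumr_eq0; last by move=> *; exact: sqr_ge0.
  rewrite mulf_eq0 orbb => /andP[/allP x1 /eqP x0].
  apply/matrixP => i j; rewrite (ord1 j) mxE.
  case: (unliftP ord0 i) => [k ->|->//].
  by move: (x1 k (mem_index_enum _)); rewrite /= sqrf_eq0 => /eqP.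
by move=> *; exact: sqr_ge0.
Qed.

Lemma positive_lorentz_unit A : positive_lorentz A -> A \in unitmx.
Proof.
move=> /asboolP[Alor _]; rewrite -unitmx_tr -row_free_unit.
apply: inj_row_free => v vA; apply: trmx_inj; rewrite trmx0.
apply: lor_nondegenerate => y; rewrite -Alor.
have -> : A *m v^T = 0 by rewrite -[A]trmxK -trmx_mul vA trmx0.
by rewrite -(scale0r 0) lorZl mul0r.
Qed.

Lemma lor_time_neq0 x : lor x x = -1 -> x 0 0 != 0.
Proof.
move=> xx; apply/eqP => x0; move: xx; rewrite /lor x0 mul0r subr0 => xx.
have : 0 <= \sum_(i < d) x (lift ord0 i) 0 * x (lift ord0 i) 0.
  by apply: sumr_ge0 => i _; rewrite -expr2 sqr_ge0.
by rewrite xx; lra.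
Qed.

Lemma positive_lorentz1 : positive_lorentz 1%:M.
Proof. by apply/asboolP; split=> [x y|x]; rewrite !mul1mx. Qed.

Lemma positive_lorentzM A B :
  positive_lorentz A -> positive_lorentz B -> positive_lorentz (A *m B).
Proof.
move=> /asboolP[A1 A2] /asboolP[B1 B2]; apply/asboolP.
split=> [x y|x hx]; first by rewrite -!mulmxA A1 B1.
by rewrite -mulmxA; apply/A2/B2.
Qed.

Lemma positive_lorentzV A : positive_lorentz A -> positive_lorentz (invmx A).
Proof.
move=> hA; have uA := positive_lorentz_unit hA; move/asboolP: hA => [A1 A2].
have V1 x y : lor (invmx A *m x) (invmx A *m y) = lor x y.
  by rewrite -A1 !mulmxA mulmxV// !mul1mx.
apply/asboolP; split=> // x [xx x0].
split; first by rewrite V1.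
rewrite ltNge; apply/negP => le0.
have [] : hyperboloid (- x).
  have -> : - x = A *m (- (invmx A *m x)) by rewrite mulmxN mulmxA mulmxV// mul1mx.
  apply: A2; split; first by rewrite lorNN V1.
  rewrite mxE oppr_gt0 lt_neqAle le0 andbT.
  by apply: lor_time_neq0; rewrite V1.
by rewrite mxE => _; lra.
Qed.

Definition isom_one : hisom := exist _ 1%:M positive_lorentz1.
Definition isom_mul (g h : hisom) : hisom :=
  exist _ (val g *m val h) (positive_lorentzM (valP g) (valP h)).
Definition isom_inv (g : hisom) : hisom := exist _ (invmx (val g)) (positive_lorentzV (valP g)).

Lemma isom_mulA : associative isom_mul.
Proof. by move=> f g h; apply: val_inj; rewrite /= mulmxA. Qed.
Lemma isom_mul1 : left_id isom_one isom_mul.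
Proof. by move=> f; apply: val_inj; rewrite /= mul1mx. Qed.
Lemma isom_mulr1 : right_id isom_one isom_mul.
Proof. by move=> f; apply: val_inj; rewrite /= mulmx1. Qed.
Lemma isom_mulV : left_inverse isom_one isom_inv isom_mul.
Proof.
by move=> f; apply: val_inj; rewrite /= mulVmx// positive_lorentz_unit// (valP f).
Qed.
Lemma isom_mulrV : right_inverse isom_one isom_inv isom_mul.
Proof.
by move=> f; apply: val_inj; rewrite /= mulmxV// positive_lorentz_unit// (valP f).
Qed.

HB.instance Definition _ := isGroup.Build hisom
  isom_mulA isom_mul1 isom_mulr1 isom_mulV isom_mulrV.

(* A vector [u] with [lor u u = 1] encodes a hyperplane together with the
   closed half-space from which [u] points outwards; all hyperplanes and
   half-spaces of H^d are of this form. *)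
Definition hyperplane u : set hspace := [set p | lor (val p) u = 0].

Definition halfspace u : set hspace := [set p | lor (val p) u <= 0].

Definition reflection u x : 'cV[R]_d.+1 := x - (2 * lor x u) *: u.

Definition convex_polyhedron (P : set hspace) : Prop :=
  (exists s : seq 'cV[R]_d.+1,
     (forall u, u \in s -> lor u u = 1) /\
     P = [set p | forall u, u \in s -> halfspace u p]) /\
  interior P !=set0.

(* The hyperbolic subspaces of dimension k of H^d are the nonempty V `&` H^d
   with V a linear subspace of dimension k+1; the codimension of a convex set
   is that of the smallest hyperbolic subspace containing it.
   For c <= d, [has_codim A c] forces A to be nonempty. *)
Definition has_codim (A : set hspace) (c : nat) : Prop :=
  exists V : {vspace 'cV[R]_d.+1},
    [/\ forall p, A p -> val p \in V,
        forall W : {vspace 'cV[R]_d.+1},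
          (forall p, A p -> val p \in W) -> (V <= W)%VS
      & (\dim V + c = d.+1)%N].

(* [u] is the outward unit normal of a codimension 1 face of P, the face
   being [P `&` hyperplane u]. *)
Definition facet_normal (P : set hspace) u : Prop :=
  [/\ lor u u = 1, P `<=` halfspace u & has_codim (P `&` hyperplane u) 1].

Definition adjacent (P : set hspace) u v : Prop :=
  has_codim (P `&` hyperplane u `&` (P `&` hyperplane v)) 2.

(* For outward unit normals the interior angle is pi minus the angle between
   the normals. *)
Definition dihedral_angle u v : R := acos (- lor u v).

Definition right_angled (P : set hspace) : Prop :=
  convex_polyhedron P /\
  forall u v, facet_normal P u -> facet_normal P v -> adjacent P u v ->
    dihedral_angle u v = pi / 2.

Definition facet_reflections (P : set hspace) : set hisom :=
  [set g | exists2 u, facet_normal P u &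
     forall p : hspace, val g *m val p = reflection u (val p)].

Lemma reflectionE u x : reflection u x = x + (- (2 * lor x u)) *: u.
Proof. by rewrite scaleNr. Qed.

Lemma lor_reflection u x y :
  lor u u = 1 -> lor (reflection u x) (reflection u y) = lor x y.
Proof.
move=> uu; rewrite !reflectionE !(lorDl, lorDr, lorZl, lorZr) uu.
by rewrite (lorC u y); ring.
Qed.

Lemma lor_CauchySchwarz x y :
  (lor x y + x 0 0 * y 0 0) ^+ 2 <=
  (lor x x + x 0 0 ^+ 2) * (lor y y + y 0 0 ^+ 2).
Proof.
have pos z : 0 <= lor z z + z 0 0 ^+ 2.
  rewrite /lor expr2 subrK; apply: sumr_ge0 => i _.
  by rewrite -expr2 sqr_ge0.
set a := lor x x + _; set b := lor y y + _; set c := lor x y + _.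
have Q s t : 0 <= s ^+ 2 * a + 2 * (s * t) * c + t ^+ 2 * b.
  have := pos (s *: x + t *: y).
  rewrite !(lorDl, lorDr, lorZl, lorZr) (lorC y x) !mxE.
  by congr (_ <= _); rewrite /a /b /c; ring.
have [b0|b0] := eqVneq b 0.
  rewrite b0 mulr0; have := Q c (- (a + 1) / 2); rewrite b0.
  have -> : c ^+ 2 * a + 2 * (c * (- (a + 1) / 2)) * c +
    (- (a + 1) / 2) ^+ 2 * 0 = - c ^+ 2 :> R by field.
  by rewrite oppr_ge0.
have bp : 0 < b by rewrite lt_neqAle eq_sym b0 pos.
have := Q b (- c).
have -> : b ^+ 2 * a + 2 * (b * - c) * c + (- c) ^+ 2 * b =
  b * (a * b - c ^+ 2) by ring.
by rewrite pmulr_rge0// subr_ge0.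
Qed.

Lemma hyperboloid_reflection u x :
  lor u u = 1 -> hyperboloid x -> hyperboloid (reflection u x).
Proof.
move=> uu [xx x0]; set y := reflection u x.
have yy : lor y y = -1 by rewrite lor_reflection.
have xy : lor x y <= -1.
  rewrite /y reflectionE lorDr lorZr xx.
  by have := sqr_ge0 (lor x u); nra.
split=> //; rewrite ltNge; apply/negP => y0.
have := lor_CauchySchwarz x y; rewrite xx yy.
set c := lor x y in xy *; set p := x 0 0 in x0 *; set q := y 0 0 in y0 *.
have : 0 <= - p * q by nra.
have := sqr_ge0 p; have := sqr_ge0 q; nra.
Qed.

Lemma reflection_isom u : lor u u = 1 ->
  exists g : hisom, forall x, val g *m x = reflection u x.
Proof.
move=> uu; pose J : 'rV[R]_d.+1 := \row_i (if i == 0 then - u i 0 else u i 0).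
pose A : 'M[R]_d.+1 := 1%:M - 2 *: (u *m J).
have AE x : A *m x = reflection u x.
  rewrite /A mulmxBl mul1mx -scalemxAl -mulmxA /reflection -scalerA.
  congr (_ - _ *: _); have -> : J *m x = (lor x u)%:M.
    rewrite [LHS]mx11_scalar; congr (_%:M).
    rewrite mxE big_ord_recl !mxE eqxx /lor addrC mulNr (mulrC (u _ _)).
    by congr (_ - _); apply: eq_bigr => i _; rewrite !mxE /= mulrC.
  by rewrite mul_mx_scalar.
have hA : positive_lorentz A.
  apply/asboolP; split=> [x y|x hx]; rewrite !AE ?lor_reflection//.
  exact: hyperboloid_reflection.
by exists (exist _ A hA : hisom).
Qed.

Definition reflection_group_pred (P : set hspace) : pred hisom :=
  fun g => g \in generated_by (facet_reflections P).

Lemma reflection_group_closed (P : set hspace) :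
  group_closed (reflection_group_pred P).
Proof.
have [g1 gM] := generated_by_subgroup (facet_reflections P).
split=> [|g h]; rewrite !unfold_in; first exact/mem_set.
by move=> /set_mem gg /set_mem gh; apply: mem_set; exact: gM.
Qed.

Definition reflection_group (P : set hspace) : Type :=
  {g : hisom | reflection_group_pred P g}.

HB.instance Definition _ P := SubChoice.on (reflection_group P).
HB.instance Definition _ P := SubChoice_isSubGroup.Build hisom
  (reflection_group_pred P) (reflection_group P) (reflection_group_closed P).

End Hyperbolic.

(* Main.v *)
From HB Require Import structures.
Require Import Defs.
From mathcomp Require Import all_boot all_order all_algebra.
From mathcomp Require Import all_classical all_reals all_analysis.
From mathcomp Require Import measurable_realfun.
From mathcomp Require Import ring lra zify.

Set Implicit Arguments.
Unset Strict Implicit.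
Unset Printing Implicit Defensive.

Import Order.TTheory GRing.Theory Num.Theory.
Import numFieldNormedType.Exports.

Local Open Scope classical_set_scope.
Local Open Scope ring_scope.

(** Let Gamma be generated by the reflections in the facets of P.

    Two facts of hyperbolic geometry are needed. First, Gamma is the
    right-angled Coxeter group on the facets of P: the outward unit normals of
    two facets are orthogonal or have Lorentz product at most -1 ([facet_ra]),
    and then a word in the reflections which fixes an interior point of P
    reduces to the empty word by exchanging orthogonal letters and cancelling
    squares ([fixing_word_trivial]). Hence an action of Gamma may be prescribed
    by involutions attached to the facets, as soon as those of orthogonal
    facets commute. Second, the graph joining non-adjacent facets is connected,
    and no single facet is an end of all its edges ([right_angled_facets]); this
    uses that P is compact.

    Fix a bi-infinite periodic walk e in that graph, through every edge. Let
    the generator v exchange n and n + 1 whenever e n = v, and fix the other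
    integers. Consecutive labels are never orthogonal, so this is an action of
    Gamma on the integers. It lifts to Gamma x Z by left multiplication on the
    first factor, and the lift may be perturbed: where v fixes the integer n,
    the pair (n, v) may be declared blocked, and v then also leaves the
    first coordinate alone. The perturbed maps still define an action provided
    that the blocked places of v are invariant under the facets orthogonal to v.
    The random subgroup is the stabilizer of (1, n) for random blocked places.

    Conjugation by g turns the stabilizer at n into the stabilizer at g n
    ([stab_conj]). So if n is uniform in a period of e and the blocked places
    are drawn from a law which is stationary and ergodic under translation by
    the period, the law of the stabilizer is invariant, and it is ergodic
    because Gamma acts transitively on the integers. It is spanning, because
    the stabilizer at n contains v as soon as (n, v) is blocked. It is
    faithful if long intervals without blocked places have positive
    probability: there g moves (1, n) to (g, g n).

    Such a law comes from the rotation of the circle R / Z by the square root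
    of 2: the k-th period carries blocked places if x + k sqrt 2 lies in A,
    where A is a periodic set of positive measure whose complement contains a
    neighbourhood of the orbit of 0 ([sparse_periodic_set]). *)

(** * Words in right-angled Coxeter groups *)

Section Words.
Variables (I : eqType) (com : rel I).
Hypothesis com_sym : symmetric com.

Definition word_act (E : Type) (f : I -> E -> E) (w : seq I) (x : E) : E := foldr f x w.

(** These are the actions of the right-angled Coxeter group whose generators
    [i] and [j] commute when [com i j]. *)
Definition ra_action (E : Type) (f : I -> E -> E) : Prop :=
  (forall i, involutive (f i)) /\
  (forall i j, com i j -> forall x, f i (f j x) = f j (f i x)).

(** Quantifying over all actions spares the construction of the abstract Coxeter
    group: equivalent words are those which have the same value there. *)
Definition word_equiv (w1 w2 : seq I) : Prop :=
  forall (E : Type) (f : I -> E -> E), ra_action f -> word_act f w1 =1 word_act f w2.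

(** The letters of [w] that can be brought to its front by exchanging commuting
    letters. If [w] is reduced, these are the left descents of the element that
    it represents. *)
Fixpoint left_descents (w : seq I) : seq I :=
  if w is t :: w' then t :: [seq s <- left_descents w' | com s t] else [::].

Fixpoint reduced (w : seq I) : bool :=
  if w is t :: w' then reduced w' && (t \notin left_descents w') else true.

Lemma word_act_cat E (f : I -> E -> E) w1 w2 x :
  word_act f (w1 ++ w2) x = word_act f w1 (word_act f w2 x).
Proof. by rewrite /word_act foldr_cat. Qed.

(** Exchanging commuting letters brings a left descent to the front. The
    conclusion on [left_descents] is what carries the induction. *)
Lemma left_descent_front w s : reduced w -> s \in left_descents w ->
  exists w', [/\ reduced (s :: w'), (size w' < size w)%N,
    word_equiv w (s :: w') & left_descents w =i left_descents (s :: w')].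
Proof.
elim: w s => [//|t w IHw] s /= /andP[rw tw]; rewrite inE.
have [-> _|st /=] := eqVneq s t.
  by exists w; split=> //=; rewrite rw.
rewrite mem_filter => /andP[cst sw].
have [w' [/= /andP[rw' sw'] szw eqw dw]] := IHw s rw sw.
exists (t :: w'); split.
- rewrite /= rw' /= inE (negPf st) /= mem_filter (negPf sw') andbF andbT.
  by apply: contra tw => tw'; rewrite dw inE mem_filter tw' andbT com_sym cst /= orbT.
- by [].
- by move=> E f [f1 f2] x /=; rewrite (eqw E f)//= f2// com_sym.
- move=> r; rewrite !inE !mem_filter !inE !mem_filter.
  have [->|rt /=] := eqVneq r t.
    by rewrite eq_sym (negPf st) /= com_sym cst.
  rewrite dw !inE !mem_filter; have [->|rs /=] := eqVneq r s.
    by rewrite cst.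
  by rewrite andbCA.
Qed.

Lemma reduced_exists w : exists2 w', reduced w' & word_equiv w w'.
Proof.
elim: w => [|t w [w' rw' eqw]]; first by exists [::].
have [tw|tw] := boolP (t \in left_descents w'); last first.
  exists (t :: w'); first by rewrite /= rw'.
  by move=> E f fP x /=; rewrite (eqw _ _ fP).
have [v [/= /andP[rv _] _ eqv _]] := left_descent_front rw' tw.
exists v => // E f fP x /=; rewrite (eqw _ _ fP) (eqv _ _ fP) /=.
by case: fP => ->.
Qed.

End Words.

(** * Right-angled systems of roots in Lorentz space *)

Section RootSystem.
Variables (R : realType) (d : nat) (I : finType).
Local Notation V := 'cV[R]_d.+1.
Variables (rho : I -> V) (x0 : V).
Hypothesis rho1 : forall i, lor (rho i) (rho i) = 1.
Hypothesis rho_ra : forall i j, i != j ->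
  lor (rho i) (rho j) = 0 \/ lor (rho i) (rho j) <= -1.
Hypothesis rho_x0 : forall i, lor x0 (rho i) < 0.

Definition at_right_angle : rel I := fun i j => lor (rho i) (rho j) == 0.
Definition refl_at i : V -> V := reflection (rho i).

Lemma ortho_sym : symmetric at_right_angle.
Proof. by move=> i j; rewrite /at_right_angle lorC. Qed.

Lemma ortho_irr : irreflexive at_right_angle.
Proof. by move=> i; rewrite /at_right_angle rho1 oner_eq0. Qed.

Lemma refl_action : ra_action at_right_angle refl_at.
Proof.
split=> [i x|i j /eqP ij x]; rewrite /refl_at !reflectionE.
  rewrite !(lorDl, lorZl) rho1 -addrA -scalerDl.
  by rewrite [X in X *: _](_ : _ = 0) ?scale0r ?addr0//; ring.
rewrite !(lorDl, lorZl) (lorC (rho j)) ij !mulr0 !addr0.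
by rewrite -!addrA [X in x + X]addrC.
Qed.

Lemma lor_refl i x v : lor (refl_at i x) v = lor x v - 2 * lor x (rho i) * lor (rho i) v.
Proof. by rewrite /refl_at reflectionE lorDl lorZl mulNr. Qed.

Local Notation pt w := (word_act refl_at w x0).
Local Notation red := (reduced at_right_angle).

(** Geometrically, if [s :: w] is reduced then the chamber of [w] lies on the
    negative side of the wall of [s]. The second statement, which strengthens
    the first for a non-orthogonal pair, is invariant under the passage from
    [(s, t)] to [(t, s)] when a letter [s] is taken off the front of [w]: the
    coefficient [k] becomes [2 c - 1 / k] with [c = - lor (rho s) (rho t)],
    which is again at least 1 since [c] is. *)
Lemma reduced_neg_rec n :
  (forall w s, (size w <= n)%N -> red (s :: w) -> lor (pt w) (rho s) <= 0) /\
  (forall w s t k, (size w <= n)%N -> red (t :: w) -> s != t -> ~~ at_right_angle s t ->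
     1 <= k -> lor (pt w) (rho s) + k * lor (pt w) (rho t) <= 0).
Proof.
have blocked_step n' :
    (forall w s, (size w <= n')%N -> red (s :: w) -> lor (pt w) (rho s) <= 0) ->
    (forall w s t k, (size w < n')%N -> red (t :: w) -> s != t ->
      ~~ at_right_angle s t -> 1 <= k -> lor (pt w) (rho s) + k * lor (pt w) (rho t) <= 0) ->
    forall w s t k, (size w <= n')%N -> red (t :: w) -> s != t -> ~~ at_right_angle s t ->
      1 <= k -> lor (pt w) (rho s) + k * lor (pt w) (rho t) <= 0.
  move=> H1 H2 w s t k szw rtw st ost k1.
  have Ht := H1 _ _ szw rtw.
  have rw : red w by case/andP: rtw.
  have [sw|sw] := boolP (s \in left_descents at_right_angle w); last first.
    by have := H1 w s szw; rewrite /= rw sw => /(_ isT); nra.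
  have [w' [rsw szw' eqw _]] := left_descent_front ortho_sym rw sw.
  rewrite (eqw _ _ refl_action) /= !lor_refl rho1.
  have [/eqP|Hc] := rho_ra st; first by rewrite -/(at_right_angle s t) (negPf ost).
  have := H2 w' t s (- 2 * lor (rho s) (rho t) - k^-1) (leq_trans szw' szw) rsw.
  rewrite eq_sym ortho_sym => /(_ st ost) H.
  have k0 : 0 < k by lra.
  have ki : k^-1 <= 1 by rewrite invf_le1.
  have /H : 1 <= - 2 * lor (rho s) (rho t) - k^-1 by lra.
  rewrite -(pmulr_rle0 _ k0); congr (_ <= 0).
  by field; rewrite gt_eqF.
elim: n => [|n [IH1 IH2]].
  have H1 w s : (size w <= 0)%N -> red (s :: w) -> lor (pt w) (rho s) <= 0.
    by rewrite leqn0 => /nilP -> _; exact: ltW.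
  by split=> //; apply: blocked_step.
have H1 w s : (size w <= n.+1)%N -> red (s :: w) -> lor (pt w) (rho s) <= 0.
  case: w => [_ _|t w]; first exact: ltW.
  rewrite /= ltnS inE negb_or mem_filter => szw.
  move=> /andP[/andP[rw tw] /andP[st]]; rewrite negb_and lor_refl.
  have rtw : red (t :: w) by rewrite /= rw.
  have [ost /= sw|ost _] := boolP (at_right_angle s t).
    have -> : lor (rho t) (rho s) = 0 by rewrite lorC; apply/eqP.
    by rewrite mulr0 subr0; apply: IH1 => //=; rewrite rw.
  have [/eqP|Hc] := rho_ra st; first by rewrite -/(at_right_angle s t) (negPf ost).
  have := IH2 w s t (- 2 * lor (rho s) (rho t)) szw rtw st ost.
  rewrite (lorC (rho t)) => H.
  have /H : 1 <= - 2 * lor (rho s) (rho t) by lra.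
  by congr (_ <= 0); ring.
by split=> //; apply: blocked_step.
Qed.

Lemma reduced_neg w s : red (s :: w) -> lor (pt w) (rho s) <= 0.
Proof. by move=> r; have [+ _] := reduced_neg_rec (size w); apply. Qed.

(** If the reduced form of [w] were [t :: v], then [x0], being the image of
    [pt v] under the reflection in [t], would be on the positive side of the
    wall of [t]. *)
Theorem fixing_word_trivial w : pt w = x0 -> word_equiv at_right_angle w [::].
Proof.
move=> wx; have [[|t v] rv eqw] := reduced_exists ortho_sym w; first by [].
have := reduced_neg rv; move: wx; rewrite (eqw _ _ refl_action) /= => wx.
have := rho_x0 t; rewrite -{1}wx lor_refl rho1; lra.
Qed.

End RootSystem.

(** * Polyhedral cones *)

Ltac vring := apply/matrixP => ? ?; rewrite !mxE; ring.

Section Farkas.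
Variables (R : realType) (d : nat).
Local Notation V := 'cV[R]_d.+1.
Implicit Types (x y z u v w : V) (ws : seq V).

Lemma lorNl x y : lor (- x) y = - lor x y.
Proof. by rewrite -scaleN1r lorZl mulN1r. Qed.

Lemma lorNr x y : lor y (- x) = - lor y x.
Proof. by rewrite lorC lorNl lorC. Qed.

Lemma lor0l y : lor 0 y = 0.
Proof. by rewrite -(scale0r 0) lorZl mul0r. Qed.

Definition lorE := (lorDl, lorDr, lorZl, lorZr, lorNl, lorNr).

(** The cone cut out by the half-spaces of outward normals [ws]. *)
Definition polar (ws : seq V) y := forall w, w \in ws -> lor y w <= 0.

Fixpoint in_cone ws u : Prop :=
  if ws is w :: ws' then exists2 c, 0 <= c & in_cone ws' (u - c *: w) else u = 0.

Lemma in_cone_polar ws u y : in_cone ws u -> polar ws y -> lor y u <= 0.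
Proof.
elim: ws u => [u -> _|w ws IH u [c c0 /IH {}IH] yw]; first by rewrite lorC lor0l.
have yw1 : lor y w <= 0 by apply: yw; rewrite mem_head.
have : lor y (u - c *: w) <= 0 by apply: IH => v vw; apply: yw; rewrite inE vw orbT.
by rewrite !lorE; nra.
Qed.

(** Undoes the projection along [w] made in the inductive step of [farkas]. *)
Lemma in_cone_shear ws w x (f : V -> R) : {in ws, forall a, f a <= 0} ->
  in_cone [seq a - f a *: w | a <- ws] x -> exists2 c, 0 <= c & in_cone ws (x - c *: w).
Proof.
elim: ws x => [x _ ->|a ws IH x fle [c0 c00 /IH]].
  by exists 0 => //=; rewrite scale0r subr0.
case=> [b bw|c c1 H]; first by apply: fle; rewrite inE bw orbT.
exists (c - c0 * f a).
  by rewrite subr_ge0 (le_trans _ c1)// mulr_ge0_le0// fle// mem_head.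
exists c0 => //; congr in_cone: H; vring.
Qed.

(** Farkas' lemma, by Bartl's induction on the number of constraints: if the
    constraint [w] cannot be omitted, there is [z] in the polar cone of the
    others with [lor z u > 0] and [lor z w > 0], and projecting along [z] to the
    hyperplane of [w] gets rid of [w]. *)
Theorem farkas ws u :
  (forall y, polar ws y -> lor y u <= 0) -> in_cone ws u.
Proof.
have [n] := ubnP (size ws); elim: n ws u => // n IH [|w ws] u /= szn H.
  apply: lor_nondegenerate => y; apply/eqP; rewrite lorC eq_le H //=.
  by have := H (- y); rewrite lorNl oppr_le0; apply.
have [H'|] := pselect (forall y, polar ws y -> lor y u <= 0).
  by exists 0 => //; rewrite scale0r subr0; apply: IH.
move=> /existsNP[z /not_implyP[zws /negP]]; rewrite -ltNge => zu.
have zw : 0 < lor z w.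
  rewrite ltNge; apply/negP => zw; have := H z; rewrite leNgt zu => /(_ _)/negP.
  by case=> // a; rewrite inE => /orP[/eqP ->//|/zws].
pose f a := lor z a / lor z w.
have [||c c0 Hc] := @in_cone_shear ws w (u - f u *: w) f.
- by move=> a /zws za; rewrite /f mulr_le0_ge0// invr_ge0 ltW.
- apply: IH => [|y Hy]; first by rewrite size_map.
  have -> : lor y (u - f u *: w) = lor (y - (lor y w / lor z w) *: z) u.
    by rewrite !lorE /f; ring.
  apply: H => a; rewrite inE => /orP[/eqP ->|aws].
    by rewrite !lorE mulfVK ?gt_eqF// subrr.
  have := Hy _ (map_f (fun a => a - f a *: w) aws).
  by rewrite !lorE /f; congr (_ <= 0); ring.
exists (f u + c); first by rewrite addr_ge0// divr_ge0// ltW.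
congr in_cone: Hc; vring.
Qed.

(** The side condition [D] lets the same statement produce the facets of a
    polyhedron and, with [D] the hyperplane of a facet, the facets of that
    facet. *)
Lemma irredundant_sub (D : V -> Prop) (l : seq V) : exists l' : seq V,
  [/\ {subset l' <= l}, uniq l',
      forall y, D y -> polar l' y -> polar l y &
      forall u, u \in l' -> exists y,
        [/\ D y, {in l', forall w, w != u -> lor y w <= 0} & 0 < lor y u]].
Proof.
wlog: l / uniq l => [|ul].
  case/(_ _ (undup_uniq l)) => l' [l'l ul' H1 H2]; exists l'; split=> //.
    by move=> v /l'l; rewrite mem_undup.
  by move=> y /H1/[apply] H v vl; apply: H; rewrite mem_undup.
have [n] := ubnP (size l); elim: n l ul => // n IH l ul szl.
have [H|/existsNP[u /not_implyP[lu Hu]]] :=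
    pselect (forall u, u \in l -> exists y,
      [/\ D y, {in l, forall w, w != u -> lor y w <= 0} & 0 < lor y u]).
  by exists l; split.
have [||l' [l'l ul' H1 H2]] := IH (rem u l); first exact: rem_uniq.
  by rewrite size_rem//; case: (l) lu szl.
exists l'; split=> //; first by move=> v /l'l /mem_rem.
move=> y Dy /(H1 _ Dy) Hy v vl.
have Hy' : {in l, forall w, w != u -> lor y w <= 0}.
  by move=> w wl wu; apply: Hy; rewrite rem_filter// mem_filter /= wu.
have [->|vu] := eqVneq v u; last exact: Hy'.
by rewrite leNgt; apply/negP => yu; apply: Hu; exists y.
Qed.

End Farkas.

(** * Causal vectors *)

Section Causal.
Variables (R : realType) (d : nat).
Local Notation V := 'cV[R]_d.+1.
Implicit Types (x y z u v w : V).

(** The squared Euclidean norm of the space-like coordinates. *)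
Definition spatial_sq x : R := lor x x + x 0 0 ^+ 2.

Lemma spatial_sqE x : spatial_sq x = \sum_(i < d) x (lift ord0 i) 0 ^+ 2.
Proof.
rewrite /spatial_sq /lor expr2 subrK; apply: eq_bigr => i _; by rewrite expr2.
Qed.

Lemma spatial_sq_ge0 x : 0 <= spatial_sq x.
Proof. by rewrite spatial_sqE sumr_ge0// => i _; exact: sqr_ge0. Qed.

Lemma spatial_sq_eq0 x : spatial_sq x = 0 -> x 0 0 = 0 -> x = 0.
Proof.
rewrite spatial_sqE => /eqP; rewrite psumr_eq0 => [/allP x1 x0|i _]; last exact: sqr_ge0.
apply/matrixP => i j; rewrite (ord1 j) mxE.
case: (unliftP ord0 i) => [k ->|->//].
by move: (x1 k (mem_index_enum _)); rewrite /= sqrf_eq0 => /eqP.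
Qed.

(** This comes from the Cauchy-Schwarz inequality for the space-like coordinates. *)
Lemma timelike_ortho x y : lor x x < 0 -> lor x y = 0 ->
  0 <= lor y y /\ (lor y y <= 0 -> y = 0).
Proof.
move=> xx xy; have := lor_CauchySchwarz x y; rewrite xy add0r.
rewrite -/(spatial_sq x) -/(spatial_sq y) => H.
have Y := spatial_sq_ge0 y; have X := spatial_sq_ge0 x.
have x2 : 0 < x 0 0 ^+ 2 by move: X; rewrite /spatial_sq; lra.
have eY : lor y y = spatial_sq y - y 0 0 ^+ 2 by rewrite /spatial_sq; ring.
have K : x 0 0 ^+ 2 * lor y y >= - lor x x * spatial_sq y.
  by move: H; rewrite eY exprMn [spatial_sq x]/spatial_sq; nra.
have yy : 0 <= lor y y by rewrite -(pmulr_rge0 _ x2) (le_trans _ K)//; nra.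
split=> // yy0; have y0 : spatial_sq y = 0 by nra.
apply: spatial_sq_eq0 => //; apply/eqP; rewrite -sqrf_eq0; apply/eqP; lra.
Qed.

Lemma future_pos x y : lor x x < 0 -> 0 < x 0 0 -> lor y y <= 0 -> lor x y < 0 ->
  0 < y 0 0.
Proof.
move=> xx x0 yy xy; rewrite ltNge; apply/negP => y0.
have := lor_CauchySchwarz x y; rewrite -/(spatial_sq x) -/(spatial_sq y).
have Y := spatial_sq_ge0 y; have X := spatial_sq_ge0 x.
have : 0 <= - x 0 0 * y 0 0 by nra.
have : spatial_sq x <= x 0 0 ^+ 2 by rewrite /spatial_sq; lra.
have : spatial_sq y <= y 0 0 ^+ 2 by rewrite /spatial_sq; lra.
move=> h1 h2 h3 h4.
have h5 : spatial_sq x * spatial_sq y <= x 0 0 ^+ 2 * y 0 0 ^+ 2 by apply: ler_pM.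
suff : (x 0 0 * y 0 0) ^+ 2 < (lor x y + x 0 0 * y 0 0) ^+ 2.
  by rewrite exprMn; lra.
set a := x 0 0 * y 0 0 in h3 *; have : a <= 0 by rewrite /a; lra.
by nra.
Qed.

(** Orthogonal causal vectors on the same side are parallel: after scaling, the
    difference of [z] and [z'] is orthogonal to [x] and not space-like. *)
Lemma causal_ortho x z z' : lor x x < 0 -> lor x z < 0 -> lor x z' < 0 ->
  lor z z <= 0 -> lor z' z' <= 0 -> lor z z' = 0 -> exists k, z = k *: z'.
Proof.
move=> xx xz xz' zz zz' z0.
have [|_] := @timelike_ortho x ((lor x z)^-1 *: z - (lor x z')^-1 *: z') xx.
  by rewrite !lorE !mulVf ?lt_eqF// subrr.
set a := (lor x z)^-1; set b := (lor x z')^-1.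
rewrite (_ : lor _ _ = a ^+ 2 * lor z z + b ^+ 2 * lor z' z'); last first.
  by rewrite !lorE (lorC z') z0; ring.
move=> H; exists (lor x z / lor x z').
have : a *: z - b *: z' = 0.
  by apply: H; have := sqr_ge0 a; have := sqr_ge0 b; nra.
move/eqP; rewrite subr_eq0 => /eqP/(congr1 (fun t => lor x z *: t)).
by rewrite !scalerA mulfV ?lt_eqF// scale1r.
Qed.

End Causal.

(** * Points of hyperbolic space *)

Section HyperbolicPoints.
Variables (R : realType) (d : nat).
Local Notation V := 'cV[R]_d.+1.
Implicit Types (x y z u v w : V) (p : hspace R d).

Lemma hspaceP p : hyperboloid (val p).
Proof. exact: set_valP. Qed.

Lemma lor_hspace p : lor (val p) (val p) = -1.
Proof. by case: (hspaceP p). Qed.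

Lemma hspace_neg p : lor (val p) (val p) < 0.
Proof. by rewrite lor_hspace ltrN10. Qed.

Lemma hspace_point p y : lor y y < 0 -> lor (val p) y < 0 ->
  exists q : hspace R d, exists2 k, 0 < k & val q = k *: y.
Proof.
move=> yy py; pose k := (Num.sqrt (- lor y y))^-1.
have k0 : 0 < k by rewrite invr_gt0 sqrtr_gt0 oppr_gt0.
have hy : hyperboloid (k *: y).
  have kk : lor (k *: y) (k *: y) = -1.
    rewrite !lorE mulrA -expr2 exprVn sqr_sqrtr ?oppr_ge0 1?ltW//.
    by rewrite invrN mulNr mulVf// lt_eqF.
  split=> //; apply: (future_pos (hspace_neg p)).
  - by case: (hspaceP p).
  - by rewrite kk lerN10.
  - by rewrite lorZr pmulr_rlt0.
by exists (exist _ (k *: y) (mem_set hy)); exists k.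
Qed.

Lemma lor_continuous u : continuous (fun x : V => lor x u).
Proof.
have H i : continuous (fun x : V => x i 0 * u i 0).
  move=> y; apply: (@cvgM R V (nbhs y) _ (fun x : V => x i 0) (fun=> u i 0)).
    exact: coord_continuous.
  exact: cvg_cst.
move=> x; apply: (@cvgB R _ V (nbhs x)); last exact: H.
apply: (@cvg_big _ _ +%R) => [|i _]; [exact: add_continuous|exact: H].
Qed.

Lemma lor_hspace_continuous u : continuous (fun p : hspace R d => lor (val p) u).
Proof.
have -> : (fun p : hspace R d => lor (val p) u) = (fun x => lor x u) \o set_val.
  by apply/funext => q; rewrite /= set_valE.
move=> p; apply: continuous_comp; last exact: lor_continuous.
exact: (@initial_continuous (hspace R d) V set_val).
Qed.

(** Were [p] on the hyperplane of [u], the geodesic from [p] with direction [u]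
    would leave [P] at once. *)
Lemma interior_strict (P : set (hspace R d)) u p : lor u u = 1 ->
  P `<=` halfspace u -> interior P p -> lor (val p) u < 0.
Proof.
move=> uu Pu; rewrite /interior /= => -[_ [[W oW <-] Wp WP]].
rewrite ltNge; apply/negP => pu.
have {pu} pu : lor (val p) u = 0.
  by apply/eqP; rewrite eq_le pu andbT; apply/Pu/WP.
pose c (e : R) : V := Num.sqrt (1 + e ^+ 2) *: val p + e *: u.
have c0 : c 0 = val p by rewrite /c expr0n addr0 sqrtr1 scale1r scale0r addr0.
have ccont : {for 0, continuous c}.
  apply: cvgD; last by apply: cvgZr_tmp; exact: cvg_id.
  apply: cvgZr_tmp; apply: continuous_comp; last exact: sqrt_continuous.
  by apply: cvgD; [exact: cvg_cst|exact: exprn_continuous].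
have : nbhs (0 : R) (c @^-1` W).
  by apply: ccont; rewrite c0; apply: open_nbhs_nbhs; split.
move=> /nbhs_ballP[e /= e0 He].
have {}He : W (c (e / 2)).
  by apply: He; rewrite /ball /= sub0r normrN gtr0_norm ?divr_gt0//; lra.
set t := e / 2 in He; have t0 : 0 < t by rewrite divr_gt0.
have s0 : 0 < 1 + t ^+ 2 by have := sqr_ge0 t; lra.
have cc : lor (c t) (c t) = -1.
  rewrite /c !lorE lor_hspace uu (lorC u) pu.
  rewrite (_ : _ + _ = - (Num.sqrt (1 + t ^+ 2)) ^+ 2 + t ^+ 2); last by ring.
  by rewrite sqr_sqrtr 1?ltW//; ring.
have hc : hyperboloid (c t).
  split=> //; apply: (future_pos (hspace_neg p)).
  - by case: (hspaceP p).
  - by rewrite cc lerN10.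
  - by rewrite /c !lorE lor_hspace pu mulr0 addr0 mulrN1 oppr_lt0 sqrtr_gt0.
have : lor (c t) u <= 0 := Pu _ (WP (exist _ (c t) (mem_set hc)) He).
by rewrite /c !lorE uu pu; lra.
Qed.

End HyperbolicPoints.

(** * Orthogonal complements *)

Section Perp.
Variables (R : realType) (d : nat).
Local Notation V := 'cV[R]_d.+1.
Implicit Types (x y z u v w : V).

(** The codomain is written [R^o] because linear maps need a module as target. *)
Definition lor_form u : V -> R^o := fun x => lor x u.

Lemma lor_form_linear u : linear (lor_form u).
Proof. by move=> a x y; rewrite /lor_form lorDl lorZl. Qed.

HB.instance Definition _ u :=
  GRing.isLinear.Build R V R^o *:%R (lor_form u) (lor_form_linear u).

Definition perp u : {vspace V} := lker (linfun (lor_form u)).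

Lemma mem_perp u x : (x \in perp u) = (lor x u == 0).
Proof. by rewrite memv_ker lfunE. Qed.

Lemma dim_cap_perp (U : {vspace V}) v :
  (\dim U <= \dim (U :&: perp v) + 1)%N /\
  ((exists2 q, q \in U & lor q v != 0) -> (\dim (U :&: perp v) + 1 = \dim U)%N).
Proof.
have := limg_ker_dim (linfun (lor_form v)) U => <-.
have le1 : (\dim (linfun (lor_form v) @: U) <= 1)%N.
  by have := dimvS (subvf (linfun (lor_form v) @: U)); rewrite dimvf.
split=> [|[q qU qv]]; first by rewrite leq_add2l.
congr (_ + _)%N; apply/eqP; rewrite eqn_leq le1 andbT lt0n dimv_eq0.
apply: contra qv => /eqP H; have := memv_img (linfun (lor_form v)) qU.
by rewrite H memv0 lfunE.
Qed.

Lemma dim_fullV : \dim {:V} = d.+1.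
Proof. by rewrite dimvf /dim /= muln1. Qed.

Lemma dim_perp u : u != 0 -> (\dim (perp u) + 1 = d.+1)%N.
Proof.
move=> u0; have [_] := dim_cap_perp fullv u; rewrite capfv dim_fullV; apply.
apply: contrapT => H; move: u0; apply/negP/negPn/eqP/lor_nondegenerate => y.
rewrite lorC; apply/eqP/negPn/negP => yu; apply: H; exists y => //; exact: memvf.
Qed.

Lemma perp2_neq0 u v : (2 <= d)%N -> exists y, [/\ y != 0, lor y u = 0 & lor y v = 0].
Proof.
move=> d2; pose W := (perp u :&: perp v)%VS.
have W0 : W != 0%VS.
  rewrite -dimv_eq0 -lt0n.
  have [h1 _] := dim_cap_perp fullv u; have [h2 _] := dim_cap_perp (perp u) v.
  move: h1 h2; rewrite capfv dim_fullV -/W => h1 h2.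
  rewrite -(ltn_add2r 1) (leq_trans _ h2)// -ltnS -[X in (_ < X)%N]addn1.
  by rewrite (leq_trans _ h1)// ltnS.
exists (vpick W); rewrite vpick0 W0; have := memv_pick W.
by rewrite memv_cap !mem_perp => /andP[/eqP -> /eqP ->].
Qed.

End Perp.

(** * The cone over a compact polyhedron *)

Section CompactCone.
Variables (R : realType) (d : nat) (s : seq 'cV[R]_d.+1) (P : set (hspace R d)).
Variable (x0 : hspace R d).
Hypotheses (d2 : (2 <= d)%N) (PE : forall p, P p <-> polar s (val p)).
Hypotheses (Pc : compact P) (x0s : forall w, w \in s -> lor (val x0) w < 0).
Local Notation V := 'cV[R]_d.+1.
Implicit Types (x y z u v w : V).
Local Notation o := (val x0).

Lemma polarD y z : polar s y -> polar s z -> polar s (y + z).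
Proof. by move=> ys zs w ws; rewrite lorDl; have := ys _ ws; have := zs _ ws; lra. Qed.

Lemma polarZ a y : 0 <= a -> polar s y -> polar s (a *: y).
Proof. by move=> a0 ys w ws; rewrite lorZl mulr_ge0_le0// ys. Qed.

Lemma polar_o : polar s o.
Proof. by move=> w /x0s/ltW. Qed.

(** Along a null direction [z] the points [o + t z], scaled back to the
    hyperboloid, escape to infinity in [P], against compactness. *)
Lemma polar_null z : polar s z -> lor z z = 0 -> ~ lor o z < 0.
Proof.
move=> zs zz oz.
have [||c cP cmax] := @compact_EVT_max (hspace R d) R (fun p => - lor (val p) o) P _ Pc.
- by exists x0; apply/PE; exact: polar_o.
- apply: continuous_subspaceT => p; apply: (@cvgN R R^o _ (nbhs p)).
  exact: lor_hspace_continuous.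
set M := - lor (val c) o in cmax.
have M1 : 1 <= M.
  have := cmax x0; rewrite lor_hspace opprK; apply; apply: mem_set.
  by apply/PE; exact: polar_o.
(* This t gives o + t z the Lorentz square - (2 M)^2; the rescaled point is then at height larger than M. *)
pose t := ((2 * M) ^+ 2 - 1) / (2 * - lor o z).
have tE : t * lor o z = - ((2 * M) ^+ 2 - 1) / 2.
  by rewrite /t; field; rewrite lt_eqF.
have yy : lor (o + t *: z) (o + t *: z) = - (2 * M) ^+ 2.
  rewrite (_ : lor _ _ = -1 + 2 * (t * lor o z)); last first.
    by rewrite !lorE lor_hspace zz (lorC z); ring.
  by rewrite tE; field.
have oy : lor o (o + t *: z) < 0.
  by rewrite !lorE lor_hspace tE; nra.
have [|q [k k0 qE]] := hspace_point _ oy; first by rewrite yy; nra.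
have Pq : P q.
  apply/PE; rewrite qE; apply: polarZ; first exact: ltW.
  apply: polarD; first exact: polar_o.
  apply: polarZ => //; rewrite divr_ge0//; first by nra.
  by rewrite mulr_ge0// oppr_ge0 ltW.
have kM : k * (2 * M) = 1.
  have := lor_hspace q; rewrite qE lorZl lorZr yy => H.
  apply/eqP; rewrite -sqrp_eq1; last by nra.
  by rewrite exprMn; apply/eqP; lra.
have := cmax q (mem_set Pq); rewrite qE lorZl lorC !lorE lor_hspace tE; nra.
Qed.

(** If [y] is not itself a future null vector, the ray with direction [y] from the
    time-like vector [o] meets the light cone, which contradicts [polar_null]. *)
Lemma polar_nontimelike y : polar s y -> 0 <= lor y y -> y = 0.
Proof.
move=> ys yy; set a := lor y y in yy; set b := lor o y.
have zs t : 0 <= t -> polar s (o + t *: y).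
  by move=> t0; apply: polarD; [exact: polar_o|exact: polarZ].
have zE t : lor (o + t *: y) (o + t *: y) = -1 + 2 * t * b + t ^+ 2 * a.
  by rewrite !lorE lor_hspace (lorC y) -/a -/b; ring.
have oE t : lor o (o + t *: y) = -1 + t * b by rewrite !lorE lor_hspace.
have [a0|a0] := eqVneq a 0.
  have [b0|b0|b0] := ltgtP b 0.
  - by have := polar_null ys a0.
  - have t0 : 0 <= (2 * b)^-1 by rewrite invr_ge0 mulr_ge0// ltW.
    have := polar_null (zs _ t0); rewrite zE oE a0.
    have -> : 2 * (2 * b)^-1 * b = 1 by field; rewrite gt_eqF.
    have -> : (2 * b)^-1 * b = 1 / 2 by field; rewrite gt_eqF.
    by rewrite mulr0 addr0 addNr => /(_ erefl) []; lra.
  - have [_] := timelike_ortho (hspace_neg x0) b0; apply.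
    by rewrite -/a a0.
have {}a0 : 0 < a by rewrite lt_neqAle eq_sym a0.
(* The positive root in t of the Lorentz square of o + t y is (S - b) / a. *)
set S := Num.sqrt (b ^+ 2 + a).
have S2 : S ^+ 2 = b ^+ 2 + a by rewrite sqr_sqrtr// addr_ge0 ?sqr_ge0// ltW.
have S0 : 0 <= S := sqrtr_ge0 _.
have t0 : 0 <= (S - b) / a by apply: divr_ge0; [nra|exact: ltW].
set t := (S - b) / a in t0; have ta : t * a = S - b by rewrite /t mulfVK ?gt_eqF.
have zz : -1 + 2 * t * b + t ^+ 2 * a = 0.
  apply: (mulIf (lt0r_neq0 a0)); rewrite mul0r.
  have -> : (-1 + 2 * t * b + t ^+ 2 * a) * a = (t * a) ^+ 2 + 2 * (t * a) * b - a.
    by ring.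
  rewrite ta (_ : _ + _ = S ^+ 2 - b ^+ 2 - a); last by ring.
  by rewrite S2; ring.
have := polar_null (zs _ t0); rewrite zE oE => /(_ zz) [].
by have := sqr_ge0 t; nra.
Qed.

Lemma cone_neq0 : exists w, w \in s.
Proof.
apply: contrapT => sn; have [y [y0 yo _]] := perp2_neq0 o o d2.
move/eqP: y0; apply; apply: polar_nontimelike => [w ws|].
  by exfalso; apply: sn; exists w.
by rewrite lorC in yo; have [] := timelike_ortho (hspace_neg x0) yo.
Qed.

(** The cone over the compact polyhedron [P] is contained in the open future cone,
    so that its nonzero vectors are exactly the positive multiples of the points of
    [P] ([cone_point]). *)
Lemma polar_future y : polar s y -> y != 0 -> lor y y < 0 /\ lor o y < 0.
Proof.
move=> ys y0; split.
  by rewrite ltNge; apply: contra y0 => /polar_nontimelike ->.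
rewrite ltNge; apply/negP => b0; set b := lor o y in b0.
have zs : polar s (y + b *: o) by apply: polarD => //; apply: polarZ => //; exact: polar_o.
have oz : lor o (y + b *: o) = 0 by rewrite !lorE lor_hspace -/b; ring.
have [z1 _] := timelike_ortho (hspace_neg x0) oz.
have {zs z1 oz} := polar_nontimelike zs z1.
move=> /eqP; rewrite addr_eq0 => /eqP yE; have [w ws] := cone_neq0.
have := ys _ ws; rewrite yE lorNl lorZl oppr_le0 => H.
have bn : b != 0 by apply: contra y0 => /eqP b0'; rewrite yE b0' scale0r oppr0.
have : 0 < b by rewrite lt_neqAle eq_sym bn.
have := x0s ws; nra.
Qed.

(** Both [y] and [- y] lie in the cone, hence would be future-directed. *)
Lemma perp_all_eq0 y : (forall w, w \in s -> lor y w = 0) -> y = 0.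
Proof.
move=> ys; apply/eqP/negPn/negP => y0.
have [|_ h1] := polar_future _ y0; first by move=> w /ys ->.
have [||_ h2] := @polar_future (- y); last by move: h1 h2; rewrite lorNr; lra.
  by move=> w /ys; rewrite lorNl => ->; rewrite oppr0.
by rewrite oppr_eq0.
Qed.

Lemma cone_point y : polar s y -> y != 0 ->
  exists p : hspace R d, P p /\ exists2 k, 0 < k & val p = k *: y.
Proof.
move=> ys y0; have [yy oy] := polar_future ys y0.
have [p [k k0 pE]] := hspace_point yy oy; exists p; split; last by exists k.
by apply/PE; rewrite pE; apply: polarZ => //; exact: ltW.
Qed.

Lemma small_step (C : seq V) r y : (forall w, w \in C -> lor r w < 0) ->
  exists2 e, 0 < e & polar C (r + e *: y).
Proof.
move=> H; suff [e e0 He] : exists2 e, 0 < e &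
    forall t, 0 < t <= e -> polar C (r + t *: y).
  by exists e => //; apply: He; rewrite e0 lexx.
elim: C H => [_|w C IH H]; first by exists 1.
have [a aC|e e0 He] := IH; first by apply: H; rewrite inE aC orbT.
have rw := H w (mem_head _ _).
exists (Num.min e (- lor r w / (`|lor y w| + 1))).
  by rewrite lt_min e0 divr_gt0 ?oppr_gt0// ltr_wpDl.
move=> t /andP[t0]; rewrite le_min => /andP[te tw] a; rewrite inE => /orP[/eqP ->|aC].
  rewrite !lorE; have n0 : 0 < `|lor y w| + 1 by rewrite ltr_wpDl.
  move: tw; rewrite ler_pdivlMr// => tw.
  by have := ler_norm (lor y w); nra.
by apply: (He t) => //; rewrite t0.
Qed.

(** [r] is a point of the relative interior of the face cut out by [W], where only
    the constraints in [C] matter; then the face spans [W]. *)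
Lemma face_codim (C : seq V) (W : {vspace V}) r (Q : set (hspace R d)) c :
  r \in W -> W != 0%VS -> (forall w, w \in C -> lor r w < 0) ->
  (forall y, y \in W -> polar C y -> polar s y) ->
  (forall p, Q p <-> P p /\ val p \in W) -> (\dim W + c = d.+1)%N ->
  has_codim Q c /\ exists p, Q p.
Proof.
move=> rW W0 rC CW QE dW.
have ex y : y \in W -> exists2 e, 0 < e &
    r + e *: y != 0 -> exists p, Q p /\ exists2 k, 0 < k & val p = k *: (r + e *: y).
  move=> yW; have [e e0 He] := small_step y rC; exists e => // n0.
  have rW' : r + e *: y \in W by rewrite memvD// memvZ.
  have [p [Pp [k k0 pE]]] := cone_point (CW _ rW' He) n0.
  exists p; split; last by exists k.
  by apply/QE; split=> //; rewrite pE memvZ.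
have r0 : r != 0.
  apply: contra W0 => /eqP r0; rewrite -vpick0; apply/eqP.
  have Cn w : w \notin C by apply/negP => /rC; rewrite r0 lor0l ltxx.
  apply: perp_all_eq0 => w ws; apply/eqP; rewrite eq_le -oppr_le0 -lorNl.
  rewrite !CW//; try by move=> a; rewrite (negPf (Cn a)).
    by rewrite memvN memv_pick.
  exact: memv_pick.
have [e _] := ex 0 (mem0v _); rewrite scaler0 addr0 => /(_ r0)[p [Qp [k k0 pE]]].
split; last by exists p.
exists W; split=> // [q /QE[]//|W' QW']; apply/subvP => y yW.
have rW' : r \in W'.
  by have := QW' _ Qp; rewrite pE => /(memvZ k^-1); rewrite scalerK// gt_eqF.
have {ex} [f f0 H] := ex y yW.
have fyW : r + f *: y \in W'.
  have [->|/H[q [Qq [l l0 qE]]]] := eqVneq (r + f *: y) 0; first exact: mem0v.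
  by have := QW' _ Qq; rewrite qE => /(memvZ l^-1); rewrite scalerK// gt_eqF.
have := memvB fyW rW'; rewrite addrC addKr => /(memvZ f^-1).
by rewrite scalerK// gt_eqF.
Qed.

End CompactCone.

(** * Facets and dihedral angles *)

Section Facets.
Variables (R : realType) (d : nat) (s : seq 'cV[R]_d.+1) (P : set (hspace R d)).
Variable (x0 : hspace R d).
Hypotheses (d2 : (2 <= d)%N) (PE : forall p, P p <-> polar s (val p)).
Hypotheses (Pc : compact P) (x0s : forall w, w \in s -> lor (val x0) w < 0).
Hypothesis s1 : forall w, w \in s -> lor w w = 1.
Hypothesis irr : forall u, u \in s -> exists y,
  {in s, forall w, w != u -> lor y w <= 0} /\ 0 < lor y u.
Local Notation V := 'cV[R]_d.+1.
Implicit Types (x y z u v w : V).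
Local Notation o := (val x0).

Lemma unit_neq0 u : lor u u = 1 -> u != 0.
Proof. by apply: contra_eq_neq => ->; rewrite lor0l eq_sym oner_eq0. Qed.

(** The relative interior point is where the segment from the interior point [o]
    to a point violating only the constraint [u] crosses the hyperplane of [u]. *)
Lemma facet_point u : u \in s ->
  exists2 q, lor q u = 0 & {in s, forall w, w != u -> lor q w < 0}.
Proof.
move=> us; have [y [ys yu]] := irr us.
have t0 : 0 < - lor o u / lor y u by rewrite divr_gt0// oppr_gt0 x0s.
exists (o + (- lor o u / lor y u) *: y).
  by rewrite !lorE mulfVK ?gt_eqF// subrr.
by move=> w ws wu; rewrite !lorE; have := x0s ws; have := ys _ ws wu; nra.
Qed.

Lemma perp_dim_gt0 u : lor u u = 1 -> perp u != 0%VS.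
Proof.
move=> u1; rewrite -dimv_eq0 -lt0n -(ltn_add2r 1) dim_perp ?unit_neq0//.
by rewrite ltnS (leq_trans _ d2).
Qed.

Lemma facet_normal_mem u : u \in s -> facet_normal P u.
Proof.
move=> us; have u1 := s1 us; have [q qu qs] := facet_point us.
split=> //; first by move=> p /PE; exact.
have [] := @face_codim _ _ s P x0 d2 PE Pc x0s [seq w <- s | w != u] (perp u) q
  (P `&` hyperplane u) 1 => //.
- by rewrite mem_perp qu.
- exact: perp_dim_gt0.
- by move=> w; rewrite mem_filter => /andP[wu ws]; exact: qs.
- move=> y; rewrite mem_perp => /eqP yu yC w ws.
  have [->|wu] := eqVneq w u; first by rewrite yu.
  by apply: yC; rewrite mem_filter wu.
- move=> p; rewrite mem_perp; split=> [[? pu]|[? /eqP pu]]; split=> //; exact/eqP.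
- by rewrite dim_perp ?unit_neq0.
Qed.

(** A normal in the cone of [ws] exposes a face contained in the hyperplane of
    some member of [ws], namely any one with a positive coefficient. *)
Lemma in_cone_support ws u : in_cone ws u -> u != 0 ->
  exists2 w, w \in ws & forall q, polar ws q -> lor q u = 0 -> lor q w = 0.
Proof.
elim: ws u => [u /= -> /eqP//|w ws IH u /= [c c0 H] u0].
have [cz|cz] := eqVneq c 0.
  move: H; rewrite cz scale0r subr0 => /IH/(_ u0)[a aws Ha].
  exists a; first by rewrite inE aws orbT.
  by move=> q qs; apply: Ha => b bws; apply: qs; rewrite inE bws orbT.
exists w; first exact: mem_head.
move=> q qs qu.
have qw : lor q w <= 0 by apply: qs; exact: mem_head.
have : lor q (u - c *: w) <= 0.
  by apply: (in_cone_polar H) => b bws; apply: qs; rewrite inE bws orbT.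
rewrite !lorE qu; have : 0 < c by rewrite lt_neqAle eq_sym cz.
by move=> cp cq; apply/eqP; rewrite eq_le qw /=; nra.
Qed.

(** By Farkas' lemma [u] is a nonnegative combination of [s]; a member of [s] with
    positive coefficient vanishes on the facet of [u], hence is parallel to [u]. *)
Lemma mem_facet_normal u : facet_normal P u -> u \in s.
Proof.
move=> [u1 Pu [W [PW minW dW]]]; have u0 := unit_neq0 u1.
have /farkas/in_cone_support/(_ u0)[w ws Hw] : forall y, polar s y -> lor y u <= 0.
  move=> y ys; have [->|y0] := eqVneq y 0; first by rewrite lor0l.
  have [p [Pp [k k0 pE]]] := cone_point d2 PE Pc x0s ys y0.
  by have := Pu _ Pp; rewrite /halfspace /= pE lorZl pmulr_rle0.
have WE : W = perp u.
  apply/eqP; rewrite eqEdim; apply/andP; split.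
    by apply: minW => p [_ pu]; rewrite mem_perp; apply/eqP.
  by rewrite -(leq_add2r 1) dim_perp// dW.
have Ww : (W <= perp w)%VS.
  apply: minW => p [/PE pP pu]; rewrite mem_perp; apply/eqP; exact: Hw.
have wE : w = lor u w *: u.
  apply/eqP; rewrite -subr_eq0; apply/eqP; apply: lor_nondegenerate => y.
  have : y - lor y u *: u \in W by rewrite WE mem_perp !lorE u1 mulr1 subrr.
  move/(subvP Ww); rewrite mem_perp !lorE => /eqP <-.
  by rewrite (lorC w) (lorC u y); ring.
have ou : lor o u <= 0 by apply: (Pu x0); apply/PE; exact: polar_o.
have ow := x0s ws; have := s1 ws; set l := lor u w in wE.
rewrite wE in ow *; rewrite wE in ws; move: ow; rewrite !lorE u1 mulr1 => ow ll.
suff l1 : l = 1 by move: ws; rewrite l1 scale1r.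
have l0 : 0 < l by nra.
by apply/eqP; rewrite -sqrp_eq1 ?expr2 ?ll// ltW.
Qed.

Lemma facet_normalE u : facet_normal P u <-> u \in s.
Proof. by split; [exact: mem_facet_normal|exact: facet_normal_mem]. Qed.

Hypothesis right : forall u v, facet_normal P u -> facet_normal P v ->
  Defs.adjacent P u v -> dihedral_angle u v = pi / 2.

(** Two facets with a common face of codimension 2 are adjacent, hence orthogonal.
    Evaluating [acos] requires [lor u v] to be in the interval from -1 to 1, which
    holds because the facets share a point. *)
Lemma face_ortho (C : seq V) u v r : u \in s -> v \in s -> u != v ->
  lor r u = 0 -> lor r v = 0 -> (forall w, w \in C -> lor r w < 0) ->
  (forall y, lor y u = 0 -> lor y v = 0 -> polar C y -> polar s y) ->
  lor u v = 0.
Proof.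
move=> us vs uv ru rv rC Cs; have u1 := s1 us; have v1 := s1 vs.
pose W := (perp u :&: perp v)%VS.
have memW y : (y \in W) = (lor y u == 0) && (lor y v == 0).
  by rewrite memv_cap !mem_perp.
have dimW : (\dim W + 2 = d.+1)%N.
  have [q qu qs] := facet_point us.
  have [_ H] := dim_cap_perp (perp u) v.
  have /H HW : exists2 q, q \in perp u & lor q v != 0.
    by exists q; rewrite ?mem_perp ?qu// lt_eqF// qs// eq_sym.
  by have := dim_perp (unit_neq0 u1); rewrite -HW -addnA.
have [||||||adj [p [[Pp pu] [_ pv]]]] := @face_codim _ _ s P x0 d2 PE Pc x0s C W r
  (P `&` hyperplane u `&` (P `&` hyperplane v)) 2.
- by rewrite memW ru rv eqxx.
- by rewrite -dimv_eq0 -lt0n -(ltn_add2r 2) dimW ltnS.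
- exact: rC.
- by move=> y; rewrite memW => /andP[/eqP yu /eqP yv]; exact: Cs.
- move=> p; rewrite memW; split=> [[[Pp /eqP pu] [_ /eqP pv]]|[Pp /andP[/eqP pu /eqP pv]]].
    by rewrite pu pv.
  by split; split.
- exact: dimW.
have := right (facet_normal_mem us) (facet_normal_mem vs) adj.
rewrite /dihedral_angle => /(congr1 cos); rewrite cos_pihalf acosK.
  by move/eqP; rewrite oppr_eq0 => /eqP.
have pp := hspace_neg p.
have puD : lor (val p) (u + v) = 0 by rewrite lorDr pu pv addr0.
have puB : lor (val p) (u - v) = 0 by rewrite lorDr lorNr pu pv subr0.
have [h1 _] := timelike_ortho pp puD; have [h2 _] := timelike_ortho pp puB.
move: h1 h2; rewrite !lorE u1 v1 (lorC v u) in_itv /= => h1 h2.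
by apply/andP; split; lra.
Qed.

(** The facets of the facet of [v] lie on adjacent facets of [P], which are
    orthogonal to [v]. By Farkas' lemma within the hyperplane of [v], [u] is then
    [lor u v] times [v] plus a nonnegative combination of normals orthogonal to
    [v]. If [lor u v] were nonnegative, [u] would be redundant, unless it is one
    of these orthogonal normals. *)
Lemma facet_ortho_or_neg u v : u \in s -> v \in s -> u != v ->
  lor u v = 0 \/ lor u v < 0.
Proof.
move=> us vs uv; have v1 := s1 vs; have [q qv qs] := facet_point vs.
have [A [As uA HA irrA]] := irredundant_sub (fun y => lor y v = 0)
  [seq w <- s | w != v].
have A_s w : w \in A -> w \in s /\ w != v.
  by move=> /As; rewrite mem_filter => /andP[].
have As' y : lor y v = 0 -> polar A y -> polar s y.
  move=> yv yA w ws; have [->|wv] := eqVneq w v; first by rewrite yv.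
  by apply: (HA y yv yA); rewrite mem_filter wv.
have Aorth w : w \in A -> lor v w = 0.
  move=> wA; have [ws wv] := A_s _ wA.
  have [y [yv yA yw]] := irrA _ wA.
  have qw := qs _ ws wv.
  pose t := - lor q w / lor y w.
  have t0 : 0 < t by rewrite divr_gt0// oppr_gt0.
  apply: (@face_ortho [seq a <- A | a != w] v w (q + t *: y)) => //.
  - by rewrite eq_sym.
  - by rewrite !lorE qv yv mulr0 addr0.
  - by rewrite !lorE /t mulfVK ?gt_eqF// subrr.
  - move=> a; rewrite mem_filter => /andP[aw aA]; have [as' av] := A_s _ aA.
    by rewrite !lorE; have := qs _ as' av; have := yA _ aA aw; nra.
  - move=> z zv zw zA; apply: As' => // a aA.
    have [->|aw] := eqVneq a w; first by rewrite zw.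
    by apply: zA; rewrite mem_filter aw.
have [uA'|uA'] := boolP (u \in A); first by left; rewrite lorC; apply: Aorth.
right; rewrite ltNge; apply/negP => uv0.
have [c1 c10 [c2 c20 Hc]] : in_cone (v :: (- v) :: A) u.
  apply: farkas => y Hy.
  have yv : lor y v = 0.
    apply/eqP; rewrite eq_le Hy ?mem_head//= -oppr_le0 -lorNr Hy//.
    by rewrite !inE eqxx orbT.
  by apply: As' => // w wA; apply: Hy; rewrite !inE wA !orbT.
have polA y : polar A y -> lor y u - c1 * lor y v + c2 * lor y v <= 0.
  by move=> yA; have := in_cone_polar Hc yA; rewrite !lorE; congr (_ <= 0); ring.
have vA a : polar A (a *: v) by move=> w /Aorth; rewrite lorZl => ->; rewrite mulr0.
have cE : c1 - c2 = lor u v.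
  have := polA _ (vA 1); have := polA _ (vA (-1)).
  by rewrite !lorE v1 (lorC v u) => h1 h2; lra.
have [y [ys yu]] := irr us.
have : lor y u - c1 * lor y v + c2 * lor y v <= 0.
  apply: polA => w wA; have [ws _] := A_s _ wA; apply: ys => //.
  by apply: contraNneq uA' => <-.
have : lor y v <= 0 by apply: ys => //; rewrite eq_sym.
nra.
Qed.

(** If [lor u v] were strictly between -1 and 0, project the interior point [o] to
    the intersection of the two hyperplanes. Since all products of distinct
    normals are nonpositive, the projection only decreases the products with the
    other normals; so it is a relative interior point of a common face of
    codimension 2, and the two facets are adjacent. *)
Lemma facet_ra u v : u \in s -> v \in s -> u != v ->
  lor u v = 0 \/ lor u v <= -1.
Proof.
move=> us vs uv; have [|uv0] := facet_ortho_or_neg us vs uv; first by left.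
have [|uv1] := leP (lor u v) (-1); first by right.
left; have u1 := s1 us; have v1 := s1 vs; set c := lor u v in uv0 uv1 *.
(* The Gram determinant of u and v; a and b are the coordinates of the projection of o to their span. *)
pose D := 1 - c ^+ 2; have D0 : 0 < D by rewrite /D; nra.
have ou := x0s us; have ov := x0s vs.
pose a := (lor o u - c * lor o v) / D; pose b := (lor o v - c * lor o u) / D.
have a0 : a < 0 by rewrite /a pmulr_llt0 ?invr_gt0//; nra.
have b0 : b < 0 by rewrite /b pmulr_llt0 ?invr_gt0//; nra.
have Dn : 1 - c ^+ 2 != 0 by rewrite gt_eqF.
apply: (@face_ortho [seq w <- s | (w != u) && (w != v)] u v (o - a *: u - b *: v)) => //.
- by rewrite !lorE u1 (lorC v u) -/c /a /b /D; field.
- by rewrite !lorE v1 -/c /a /b /D; field.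
- move=> w; rewrite mem_filter => /andP[/andP[wu wv] ws].
  have ow := x0s ws; rewrite !lorE.
  have uw : lor u w <= 0.
    by rewrite eq_sym in wu; have [->|/ltW] := facet_ortho_or_neg us ws wu.
  have vw : lor v w <= 0.
    by rewrite eq_sym in wv; have [->|/ltW] := facet_ortho_or_neg vs ws wv.
  nra.
- move=> y yu yv yC w ws; have [->|wu] := eqVneq w u; first by rewrite yu.
  have [->|wv] := eqVneq w v; first by rewrite yv.
  by apply: yC; rewrite mem_filter wu wv.
Qed.

End Facets.

(** * The graph of non-adjacent facets *)

Section FacetGraph.
Variables (R : realType) (d : nat) (s : seq 'cV[R]_d.+1) (P : set (hspace R d)).
Variable (x0 : hspace R d).
Hypotheses (d2 : (2 <= d)%N) (PE : forall p, P p <-> polar s (val p)).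
Hypotheses (Pc : compact P) (x0s : forall w, w \in s -> lor (val x0) w < 0).
Hypothesis s1 : forall w, w \in s -> lor w w = 1.
Hypothesis ra : forall u v, u \in s -> v \in s -> u != v ->
  lor u v = 0 \/ lor u v <= -1.
Local Notation V := 'cV[R]_d.+1.
Implicit Types (x y z u v w : V).
Local Notation o := (val x0).

Local Notation nontimelike := (polar_nontimelike PE Pc x0s).

(** Otherwise [- u] would belong to the cone of [P], although it is space-like. *)
Lemma facet_nonadjacent u : u \in s -> exists2 v, v \in s & lor u v <= -1.
Proof.
move=> us; apply: contrapT => H; have u1 := s1 us.
suff /eqP : - u = 0 by rewrite oppr_eq0 (negPf (unit_neq0 u1)).
apply: nontimelike; last by rewrite !lorE u1 opprK.
move=> w ws; rewrite lorNl oppr_le0; have [->|wu] := eqVneq w u; first by rewrite u1.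
rewrite eq_sym in wu; have [->//|h] := ra us ws wu.
by exfalso; apply: H; exists w.
Qed.

Lemma nonadjacent_neq u v : u \in s -> lor u v <= -1 -> u != v.
Proof. by move=> us; apply: contraTneq => <-; rewrite s1// -ltNge; lra. Qed.

(** Otherwise all facets but [u] are pairwise orthogonal, and by
    [facet_nonadjacent] none of them is adjacent to [u]. For two of them, [v] and
    [w], the complement of [u] and [v] contains a vector of the cone which is not
    time-like; if [v] is the only one, that complement is orthogonal to all facets. *)
Lemma nonadjacent_avoiding u : u \in s -> exists v w,
  [/\ v \in s, w \in s, v != u, w != u & lor v w <= -1].
Proof.
move=> us; apply: contrapT => H; have u1 := s1 us.
have orth v w : v \in s -> w \in s -> v != u -> w != u -> v != w -> lor v w = 0.
  move=> vs ws vu wu vw; have [//|h] := ra vs ws vw.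
  by exfalso; apply: H; exists v, w.
have nadj v : v \in s -> v != u -> lor u v <= -1.
  move=> vs vu; have [w ws vw] := facet_nonadjacent vs.
  have [<-|wu] := eqVneq w u; first by rewrite lorC.
  have := orth _ _ vs ws vu wu (nonadjacent_neq vs vw); lra.
have [v vs uv] := facet_nonadjacent us.
have vu : v != u by rewrite eq_sym; exact: nonadjacent_neq uv.
have [[w [ws wu wv]]|Hw] := pselect (exists w, [/\ w \in s, w != u & w != v]).
  set c := lor u v in uv; have uw := nadj _ ws wu; set c' := lor u w in uw.
  have vw : lor v w = 0 by apply: orth => //; rewrite eq_sym.
  (* The combination of u, v and w orthogonal to u and v. *)
  pose k := (c ^+ 2 - 1) / - c'; pose y := u - c *: v - k *: w.
  have k0 : 0 <= k by rewrite divr_ge0//; nra.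
  have kc' : k * c' = 1 - c ^+ 2 by rewrite /k; field; lra.
  have yu : lor y u = 0.
    by rewrite /y !lorE u1 (lorC v u) (lorC w u) -/c -/c' kc'; ring.
  have yv : lor y v = 0.
    by rewrite /y !lorE (s1 vs) (lorC w v) vw -/c; ring.
  have yw : lor y w = c' - k.
    by rewrite /y !lorE (s1 ws) vw -/c'; ring.
  suff y0 : y = 0 by move: yw; rewrite y0 lor0l; lra.
  apply: nontimelike; last first.
    rewrite {2}/y lorDr lorDr lorNr lorNr !lorZr yu yv yw; nra.
  move=> a as'; have [->|au] := eqVneq a u; first by rewrite yu.
  have [->|av] := eqVneq a v; first by rewrite yv.
  have [->|aw] := eqVneq a w; first by rewrite yw; lra.
  have ua := nadj _ as' au; rewrite /y !lorE.
  rewrite (orth v a) ?(orth w a)//; try by rewrite eq_sym.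
  lra.
have [y [y0 yu yv]] := perp2_neq0 u v d2.
move/eqP: y0; apply; apply: (perp_all_eq0 d2 PE Pc x0s) => w ws.
have [->//|wu] := eqVneq w u; have [->//|wv] := eqVneq w v.
by exfalso; apply: Hw; exists w.
Qed.

(** The graph of non-adjacent facets is connected. Pairs of non-adjacent facets
    in two distinct components give orthogonal causal vectors [u + u'] and
    [v + v'], hence parallel ones; then [u + u'] is orthogonal to all facets. *)
Lemma facets_irreducible (A : V -> Prop) u v :
  u \in s -> v \in s -> A u ->
  (forall a b, a \in s -> b \in s -> lor a b <= -1 -> A a -> A b) -> A v.
Proof.
move=> us vs Au HA; apply: contrapT => nAv.
have [u' us' uu'] := facet_nonadjacent us; have [v' vs' vv'] := facet_nonadjacent vs.
have Au' : A u' := HA _ _ us us' uu' Au.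
have nAv' : ~ A v' by move=> Av'; apply: nAv; apply: (HA _ _ vs' vs) => //; rewrite lorC.
have orth a b : a \in s -> b \in s -> A a -> ~ A b -> lor a b = 0.
  move=> as' bs Aa nAb; have [|//|h] := ra as' bs.
    by apply: contra_notN nAb => /eqP <-.
  by exfalso; apply: nAb; exact: HA h Aa.
have zz a b : a \in s -> b \in s -> lor a b <= -1 -> lor (a + b) (a + b) <= 0.
  by move=> as' bs ab; rewrite !lorE !s1// (lorC b); lra.
have [||||||k kE] := @causal_ortho _ _ o (u + u') (v + v').
- exact: hspace_neg.
- by rewrite lorDr; have := x0s us; have := x0s us'; lra.
- by rewrite lorDr; have := x0s vs; have := x0s vs'; lra.
- exact: zz.
- exact: zz.
- by rewrite !lorE !orth// !addr0.
suff z0 : u + u' = 0.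
  by have := x0s us; have := x0s us'; have := lor0l o; rewrite lorC -z0 lorDr; lra.
apply: (perp_all_eq0 d2 PE Pc x0s) => w ws.
have [Aw|nAw] := pselect (A w).
  by rewrite kE lorC !lorE !orth// !(addr0, mulr0).
by rewrite lorDl !orth// addr0.
Qed.

End FacetGraph.

(** The consequences of the geometry of [P] used in the construction: a root
    system for the group, and a graph that carries the walk. *)
Theorem right_angled_facets (R : realType) (d : nat) (P : set (hspace R d)) :
  (2 <= d)%N -> compact P -> right_angled P ->
  exists (n : nat) (rho : 'I_n.+1 -> 'cV[R]_d.+1) (x0 : hspace R d),
  let nadj := [rel i j | lor (rho i) (rho j) <= -1] in
  [/\ forall u, facet_normal P u <-> exists i, u = rho i,
      [/\ forall i, lor (rho i) (rho i) = 1,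
      forall i j, i != j -> lor (rho i) (rho j) = 0 \/ lor (rho i) (rho j) <= -1 &
      forall i, lor (val x0) (rho i) < 0] &
      [/\ forall i, exists j, nadj i j,
      forall i, exists j k, [/\ j != i, k != i & nadj j k] &
      forall i j, connect nadj i j]].
Proof.
move=> d2 Pc [[[s0 [s01 P0]] [x0 intx0]] right].
have [s [ss0 us Hs irr]] := irredundant_sub (fun=> True) s0.
have PE p : P p <-> polar s (val p).
  rewrite P0; split=> [H w /ss0/H//|/(Hs _ I) H u us0]; exact: H.
have s1 w : w \in s -> lor w w = 1 by move=> /ss0/s01.
have x0s w : w \in s -> lor (val x0) w < 0.
  by move=> ws; apply: (interior_strict (s1 _ ws) _ intx0) => p /PE; exact.
have irr' u : u \in s -> exists y,
    {in s, forall w, w != u -> lor y w <= 0} /\ 0 < lor y u.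
  by move=> /irr[y [_ y1 y2]]; exists y.
have ra := facet_ra d2 PE Pc x0s s1 irr' right.
have fE := facet_normalE d2 PE Pc x0s s1 irr'.
have sn : size s = (size s).-1.+1.
  by have [w] := cone_neq0 d2 PE Pc x0s; case: (s).
pose rho (i : 'I_(size s).-1.+1) := nth 0 s i.
have ri (i : 'I_(size s).-1.+1) : (i < size s)%N.
  by apply: leq_trans (ltn_ord i) _; rewrite -sn.
have rs i : rho i \in s by rewrite mem_nth.
have rinj : injective rho.
  by move=> i j /(congr1 (index^~ s)); rewrite /rho !index_uniq// => /val_inj.
have sr u : u \in s -> exists i, u = rho i.
  move=> /(nthP 0)[i i_s <-]; rewrite sn in i_s.
  by exists (Ordinal i_s).
exists (size s).-1, rho, x0 => nadj; split; [|split|split].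
- by move=> u; rewrite fE; split=> [/sr//|[i ->]].
- by move=> i; exact: s1.
- move=> i j ij; apply: ra => //; by apply: contra ij => /eqP/rinj ->.
- by move=> i; exact: x0s.
- move=> i; have [v vs iv] := facet_nonadjacent PE Pc x0s s1 ra (rs i).
  by have [j vE] := sr _ vs; exists j; rewrite /= -vE.
- move=> i; have [v [w [vs ws vi wi vw]]] :=
    nonadjacent_avoiding d2 PE Pc x0s s1 ra (rs i).
  have [j vE] := sr _ vs; have [k wE] := sr _ ws; exists j, k; split.
  + by apply: contra vi => /eqP <-; rewrite -vE.
  + by apply: contra wi => /eqP <-; rewrite -wE.
  + by rewrite /= -vE -wE.
- move=> i j.
  have [] := facets_irreducible d2 PE Pc x0s s1 ra (A := fun v =>
    exists2 k, v = rho k & connect nadj i k) (rs i) (rs j).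
  + by exists i => //; exact: connect0.
  + move=> a b as' bs ab [k aE ik]; have [l bE] := sr _ bs.
    exists l => //; apply: connect_trans ik _; apply: connect1.
    by rewrite /= -aE -bE.
  + by move=> k /rinj ->.
Qed.

(** * Closed walks in connected graphs *)

Section ClosedWalk.
Variables (I : finType) (r : rel I).
Hypotheses (conn : forall i j, connect r i j) (nbr : forall i, exists j, r i j).

Lemma closed_path_through x (L : seq (I * I)) :
  {in L, forall a, r a.1 a.2} -> exists p : seq I,
  [/\ path r x p, last x p = x &
      {in L, forall a, exists p1 p2, p = p1 ++ a.2 :: p2 /\ last x p1 = a.1}].
Proof.
elim: L => [_|[a b] L IH rL]; first by exists [::].
have [c cL|p [pp lp Lp]] := IH; first by apply: rL; rewrite inE cL orbT.
have rab : r a b by apply: (rL (a, b)); rewrite mem_head.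
have /connectP[q1 pq1 aE] := conn x a; have /connectP[q2 pq2 xE] := conn b x.
exists (q1 ++ b :: q2 ++ p); split.
- by rewrite cat_path pq1 /= -aE rab cat_path pq2 -xE.
- by rewrite last_cat /= last_cat -xE.
- move=> c; rewrite inE => /orP[/eqP -> /=|cL]; first by exists q1, (q2 ++ p).
  have [p1 [p2 [-> <-]]] := Lp _ cL; exists (q1 ++ b :: q2 ++ p1), p2.
  by rewrite -catA /= -catA; split=> //; rewrite last_cat /= last_cat -xE.
Qed.

Lemma periodic_walk : I -> exists (N : nat) (e : int -> I),
  [/\ (0 < N)%N, forall n, e (n + N%:Z) = e n, forall n, r (e n) (e (n + 1)) &
      forall i j, r i j -> exists n, e n = i /\ e (n + 1) = j].
Proof.
move=> x; pose L := [seq a <- enum {: I * I} | r a.1 a.2].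
have [|p [pp lp Lp]] := @closed_path_through x L.
  by move=> a; rewrite mem_filter => /andP[].
have memL i j : r i j -> (i, j) \in L by move=> rij; rewrite mem_filter /= rij mem_enum.
have N0 : (0 < size p)%N.
  by have [j /memL/Lp[p1 [p2 [-> _]]]] := nbr x; rewrite size_cat /= addnS.
pose N := size p; pose e (n : int) := nth x (x :: p) `|(n %% N%:Z)%Z|%N.
have eS (n : int) : e (n + 1) = nth x p `|(n %% N%:Z)%Z|%N.
  rewrite /e -modzDml; have : (`|(n %% N%:Z)%Z| < N)%N by lia.
  have : (n %% N%:Z)%Z = `|(n %% N%:Z)%Z|%N by lia.
  move: `|_|%N => m ->; rewrite leq_eqVlt => /orP[/eqP mN|mN].
    have -> : (m%:Z + 1)%R = N%:Z by lia.
    by rewrite modzz /= -{1}lp (last_nth x) -/N -mN.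
  have -> : (m%:Z + 1)%R = m.+1 by lia.
  by rewrite modz_small// ltz_nat.
exists N, e; split=> //.
- by move=> n; rewrite /e modzDr.
- move=> n; rewrite eS /e; apply: (pathP _ pp); rewrite -/N; lia.
- move=> i j /memL/Lp[p1 [p2 [/= pE iE]]]; exists (size p1)%:Z.
  have sN : (size p1 < N)%N by rewrite /N pE size_cat /= addnS ltnS leq_addr.
  rewrite eS /e; have -> : `|((size p1)%:Z %% N%:Z)%Z|%N = size p1.
    by rewrite modz_small// ltz_nat.
  split; last by rewrite pE nth_cat ltnn subnn.
  by rewrite pE -cat_cons nth_cat /= ltnSn -iE (last_nth x).
Qed.

End ClosedWalk.

(** * Actions prescribed on the generators *)

Section RightAngledCoxeterGroup.
Variables (G : groupType) (I : finType) (com : rel I) (gen : I -> G).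
Local Open Scope group_scope.

Definition word_prod (w : seq I) : G := foldr (fun i g => gen i * g) 1 w.

(** The relations of [com] define [G], in the form needed to extend actions from
    the generators. *)
Record racg : Prop := Racg {
  com_symm : symmetric com;
  com_irrefl : irreflexive com;
  gen2 : forall i, gen i * gen i = 1;
  gen_com : forall i j, com i j -> gen i * gen j = gen j * gen i;
  gen_word : forall g, exists w, word_prod w = g;
  gen_rel : forall w, word_prod w = 1 -> word_equiv com w [::] }.

Hypothesis GP : racg.

Definition word g : seq I := projT1 (cid (gen_word GP g)).
Lemma word_prod_word g : word_prod (word g) = g.
Proof. by rewrite /word; case: cid. Qed.

Lemma word_prod_cat w1 w2 : word_prod (w1 ++ w2) = word_prod w1 * word_prod w2.
Proof. by elim: w1 => [|i w1 IH] /=; rewrite ?mul1g// IH mulgA. Qed.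

Lemma word_act_rev E (f : I -> E -> E) w x : ra_action com f ->
  word_act f w (word_act f (rev w) x) = x.
Proof.
move=> [f1 _]; elim: w x => [//|i w IH] x.
by rewrite rev_cons -cats1 word_act_cat /= IH f1.
Qed.

Lemma left_mul_action : ra_action com (fun i g => gen i * g).
Proof.
split=> [i g|i j ij g]; first by rewrite mulgA gen2// mul1g.
by rewrite !mulgA gen_com.
Qed.

Lemma word_prod_rev w : word_prod (rev w) * word_prod w = 1.
Proof.
rewrite -word_prod_cat; have := word_act_rev (rev w) 1 left_mul_action.
by rewrite revK -word_act_cat.
Qed.

Lemma word_prod_equiv w1 w2 : word_prod w1 = word_prod w2 -> word_equiv com w1 w2.
Proof.
move=> w12 E f fP x; have : word_prod (rev w2 ++ w1) = 1.
  by rewrite word_prod_cat w12 word_prod_rev.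
move/(gen_rel GP)/(_ E f fP x); rewrite word_act_cat /= => H.
by rewrite -[LHS](word_act_rev w2 _ fP) H.
Qed.

(** The action of [G] prescribed by the maps [f i] on generators, through an
    arbitrary choice of words. *)
Definition group_act E (f : I -> E -> E) g x := word_act f (word g) x.

Section Gact.
Variables (E : Type) (f : I -> E -> E).
Hypothesis fP : ra_action com f.

Lemma group_act_word_prod w x : group_act f (word_prod w) x = word_act f w x.
Proof. by apply: word_prod_equiv => //; rewrite word_prod_word. Qed.

Lemma group_act1 x : group_act f 1 x = x.
Proof. exact: (group_act_word_prod [::]). Qed.

Lemma group_actM g h x : group_act f (g * h) x = group_act f g (group_act f h x).
Proof. by rewrite -{1}(word_prod_word g) -{1}(word_prod_word h) -word_prod_cat group_act_word_prod word_act_cat. Qed.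

Lemma group_actK g x : group_act f g^-1 (group_act f g x) = x.
Proof. by rewrite -group_actM mulVg group_act1. Qed.

Lemma group_actKV g x : group_act f g (group_act f g^-1 x) = x.
Proof. by rewrite -group_actM mulgV group_act1. Qed.

End Gact.

Section Walk.
Variable e : int -> I.
Hypothesis e_adj : forall n, (e n != e (n + 1)%R) && ~~ com (e n) (e (n + 1)%R).

(** The generator [v] exchanges the ends of the edges with label [v] in the line
    graph on the integers. *)
Definition walk_move v (n : int) : int :=
  if v == e n then n + 1 else if v == e (n - 1) then n - 1 else n.

Lemma e_neq n : e (n - 1) == e n = false.
Proof. by have := e_adj (n - 1); rewrite subrK => /andP[/negPf]. Qed.

Lemma e_neq' n : e (n + 1) == e n = false.
Proof. by have /andP[/negPf] := e_adj n; rewrite eq_sym. Qed.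

(** Commuting generators never label consecutive edges, so one of them fixes both
    ends of any edge labelled by the other. *)
Lemma walk_move_action : ra_action com walk_move.
Proof.
have cN n v v' : com v v' -> v = e n -> v' = e (n + 1) -> False.
  by move=> vv' vE v'E; have := e_adj n; rewrite -vE -v'E vv' andbF.
split=> [v n|v v' vv' n].
  rewrite /walk_move; case: (eqVneq v (e n)) => [->|vn].
    by rewrite eq_sym e_neq' addrK eqxx.
  case: (eqVneq v (e (n - 1))) => [->|vn1]; first by rewrite eqxx subrK.
  by rewrite (negPf vn) (negPf vn1).
have v'v : com v' v by rewrite com_symm.
have vneq : v != v' by apply: contraTneq vv' => ->; rewrite com_irrefl.
wlog: v v' vv' v'v vneq / (v == e n) || (v == e (n - 1)).
  move=> W; have [|Hv] := boolP ((v == e n) || (v == e (n - 1))); first exact: W.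
  have [Hv'|Hv'] := boolP ((v' == e n) || (v' == e (n - 1))).
    by symmetry; apply: W => //; rewrite eq_sym.
  move: Hv Hv'; rewrite !negb_or /walk_move.
  by move=> /andP[/negPf h1 /negPf h2] /andP[/negPf h3 /negPf h4]; rewrite h3 h4 h1 h2 h3 h4.
move=> Hv.
have fix' m : (v == e m) || (v == e (m - 1)) -> walk_move v' m = m.
  move=> Hm; rewrite /walk_move; case: (eqVneq v' (e m)) => [v'E|_].
    case/orP: Hm => /eqP vE; first by rewrite vE v'E eqxx in vneq.
    by case: (cN (m - 1) v v'); rewrite ?subrK.
  case: (eqVneq v' (e (m - 1))) => [v'E|//].
  case/orP: Hm => /eqP vE; last by rewrite vE v'E eqxx in vneq.
  by case: (cN (m - 1) v' v); rewrite ?subrK.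
rewrite (fix' n)// fix'//.
rewrite /walk_move; case/orP: Hv => /eqP ->; first by rewrite eqxx addrK eqxx orbT.
by rewrite e_neq eqxx eqxx.
Qed.

Section Selection.
Variable blocked : int -> I -> bool.
Hypothesis blocked_fix : forall n v, blocked n v -> (v != e n) && (v != e (n - 1)).
Hypothesis blocked_com : forall n v v', com v' v -> blocked (walk_move v' n) v = blocked n v.

(** The first coordinate records the element of [G] reached by a path, without
    the letters applied at blocked places. *)
Definition blocked_step v (a : G * int) : G * int :=
  if blocked a.2 v then a else ((gen v * a.1)%g, walk_move v a.2).

Lemma blocked_move n v : blocked n v -> walk_move v n = n.
Proof. by rewrite /walk_move => /blocked_fix/andP[/negPf -> /negPf ->]. Qed.

Lemma blocked_self n v : blocked (walk_move v n) v = blocked n v.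
Proof.
have [m1 _] := walk_move_action; apply/idP/idP => [s|s].
  by move: (s); rewrite -{2}(m1 v n) (blocked_move s) .
by rewrite (blocked_move s).
Qed.

Lemma blocked_step_action : ra_action com blocked_step.
Proof.
split=> [v [g n]|v v' vv' [g n]]; rewrite /blocked_step /=.
  case: (boolP (blocked n v)) => s /=; first by rewrite s.
  by rewrite blocked_self (negPf s) mulgA gen2// mul1g; case: walk_move_action => ->.
have v'v : com v' v by rewrite com_symm.
case: (boolP (blocked n v')) => s' /=; case: (boolP (blocked n v)) => s /=.
- by rewrite s'.
- by rewrite blocked_com ?s'.
- by rewrite blocked_com ?s// (negPf s').
- rewrite !blocked_com// (negPf s) (negPf s') !mulgA gen_com//; congr pair.
  by case: walk_move_action => _ ->.
Qed.

Definition stab n (g : G) : bool := group_act blocked_step g (1%g, n) == (1%g, n).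

Lemma blocked_step_snd w a : (word_act blocked_step w a).2 = word_act walk_move w a.2.
Proof.
elim: w => [//|v w IH] /=; rewrite -IH /blocked_step; case: ifP => //= s.
by rewrite blocked_move.
Qed.

Lemma blocked_step_mulr w g h n :
  word_act blocked_step w ((g * h)%g, n) = ((word_act blocked_step w (g, n)).1 * h, (word_act blocked_step w (g, n)).2)%g.
Proof.
elim: w => [//|v w IH] /=; rewrite IH /blocked_step /=.
by case: ifP => //= _; rewrite mulgA.
Qed.

Lemma stab_subgroup n : is_subgroup [set g | stab n g]%classic.
Proof.
have sP := blocked_step_action; split=> [|g h]; rewrite /= /stab; first by rewrite group_act1.
move=> /eqP gn /eqP hn; rewrite group_actM//.
by rewrite -{1}hn group_actK// gn.
Qed.

(** The stabilizer at [n] is conjugate to that of the image [(t, m)] of [(1, n)]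
    under [g], and right multiplication by [t] commutes with the action. *)
Lemma stab_conj g h n : stab n (h ^ g)%g = stab (group_act walk_move g n) h.
Proof.
have sP := blocked_step_action; rewrite /stab conjgE !group_actM//.
case E : (group_act blocked_step g (1%g, n)) => [t m].
have -> : group_act walk_move g n = m.
  by have := blocked_step_snd (word g) (1%g, n); rewrite -/(group_act _ _ _) E.
have H : group_act blocked_step h (t, m) =
    ((group_act blocked_step h (1%g, m)).1 * t, (group_act blocked_step h (1%g, m)).2)%g.
  by rewrite -{1}(mul1g t) /group_act blocked_step_mulr.
have -> : (group_act blocked_step g^-1 (group_act blocked_step h (t, m)) == (1%g, n)) =
    (group_act blocked_step h (t, m) == (t, m)).
  apply/eqP/eqP => [H'|->]; last by rewrite -E group_actK.
  by rewrite -[LHS](group_actKV sP g) H' E.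
rewrite H; case: (group_act blocked_step h (1%g, m)) => a b /=.
apply/eqP/eqP => [[/(canRL (mulgK _))]|[-> ->]]; last by rewrite mul1g.
by rewrite mulgV => -> ->.
Qed.

Lemma word_act_unblocked w n : (forall w' v, size w' < size w -> ~~ blocked (word_act walk_move w' n) v)%N ->
  word_act blocked_step w (1%g, n) = (word_prod w, word_act walk_move w n).
Proof.
elim: w => [//|v w IH] H /=; rewrite IH; last first.
  by move=> w' v' sz; apply: H; rewrite (leq_trans sz)//= leqnSn.
by rewrite /blocked_step /= (negPf (H w v _)).
Qed.

End Selection.

Lemma stab_shift (blocked blocked' : int -> I -> bool) m n g :
  (forall n, e (n + m) = e n) -> (forall n v, blocked' n v = blocked (n + m) v) ->
  stab blocked' n g = stab blocked (n + m) g.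
Proof.
move=> em ss; have mm v k : walk_move v (k + m) = walk_move v k + m.
  rewrite /walk_move em (addrAC k m (-1)%R) em (addrAC k m 1%R).
  by case: ifP => // _; case: ifP.
suff H w a : word_act (blocked_step blocked) w (a.1, a.2 + m) =
    ((word_act (blocked_step blocked') w a).1, (word_act (blocked_step blocked') w a).2 + m).
  rewrite /stab /group_act (H _ (1%g, n)); case: (word_act _ _ _) => a b /=.
  by rewrite !xpair_eqE (inj_eq (addIr m)).
elim: w => [//|v w IH] /=; rewrite IH /blocked_step /= -ss.
by case: ifP => //= _; rewrite mm.
Qed.

End Walk.
End RightAngledCoxeterGroup.

(** * Rotation of the circle by the square root of 2 *)

Lemma absz_eq_or (k : int) (n : nat) : `|k|%N = n -> k = n%:Z \/ k = - n%:Z.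
Proof. by case: k => m <-; [left|right; rewrite NegzE]. Qed.

Section Rotation.
Variable R : realType.
Local Notation mu := (@lebesgue_measure R).
Implicit Types (A B : set (measurableTypeR R)) (a b x : R).

Definition translate a B : set (measurableTypeR R) := [set x | B (x + a)].

Definition shift_right a : measurableTypeR R -> measurableTypeR R := fun x => x + a.

Lemma measurable_shift_right a : measurable_fun [set: measurableTypeR R] (shift_right a).
Proof. by apply: measurable_funD. Qed.

HB.instance Definition _ a :=
  isMeasurableFun.Build _ _ _ _ (shift_right a) (measurable_shift_right a).

Lemma measurable_translate a B : measurable B -> measurable (translate a B).
Proof. by move=> mB; rewrite -[translate a B]setTI; exact: measurable_shift_right. Qed.

Lemma leb_translate a B : measurable B -> mu (translate a B) = mu B.
Proof.
move=> mB; pose f := shift_right a; pose nu := pushforward mu f.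
suff : mu B = nu B by move=> ->.
apply: (@lebesgue_measure_unique R nu) => // _ [[c e]] _ <-.
rewrite /nu /pushforward.
rewrite [X in _ = mu X](_ : _ = `]c - a, e - a]%classic); last first.
  by apply/seteqP; split=> y; rewrite /f /shift_right /= !in_itv /= ltrBlDr lerBrDr.
rewrite !lebesgue_measure_itv /= !lte_fin ltrD2r.
by case: ifP => // _; rewrite -!EFinB; congr (_%:E); ring.
Qed.

Definition leb_itv B a b := mu (B `&` `]a, b]).

Lemma measurable_cap_itv B a b : measurable B -> measurable (B `&` `]a, b]).
Proof. by move=> mB; apply: measurableI => //; exact: measurable_itv. Qed.

Lemma leb_itv_le B a b a' b' : measurable B -> a' <= a -> b <= b' ->
  (leb_itv B a b <= leb_itv B a' b')%E.
Proof.
move=> mB aa bb; apply: le_measure; rewrite ?inE; try exact: measurable_cap_itv.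
move=> x [Bx]; rewrite /= !in_itv /= => /andP[ax xb]; split=> //.
by rewrite (le_lt_trans aa ax) (le_trans xb bb).
Qed.

Lemma leb_itv_bound B a b : measurable B -> a <= b -> (leb_itv B a b <= (b - a)%:E)%E.
Proof.
move=> mB ab; have -> : (b - a)%:E = mu `]a, b].
  rewrite lebesgue_measure_itv /= lte_fin; case: ltP => // ba.
  by have -> : b = a; [lra|rewrite subrr].
by apply: le_measure; rewrite ?inE//; exact: measurable_cap_itv.
Qed.

Lemma leb_itv_fin B a b : measurable B -> a <= b -> leb_itv B a b \is a fin_num.
Proof.
move=> mB ab; rewrite ge0_fin_numE ?measure_ge0//.
by rewrite (le_lt_trans (leb_itv_bound mB ab))// ltry.
Qed.

Lemma leb_itvD B a b c : measurable B -> a <= b -> b <= c ->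
  leb_itv B a c = (leb_itv B a b + leb_itv B b c)%E.
Proof.
move=> mB ab bc; rewrite /leb_itv -measureU; try exact: measurable_cap_itv.
  rewrite -setIUr; congr (mu (_ `&` _)); apply/seteqP; split=> x; rewrite /= !in_itv /=.
    move=> /andP[ax xc]; have [xb|bx] := leP x b; [left|right]; rewrite ?in_itv/=.
      by rewrite ax.
    by rewrite xc.
  case=> /andP[h1 h2]; apply/andP; split=> //.
    exact: le_trans bc.
  exact: le_lt_trans h1.
rewrite -subset0 => x [[_ +] [_]]; rewrite /= !in_itv /= => /andP[_ xb] /andP[bx].
by rewrite ltNge xb in bx.
Qed.

Lemma leb_itv_translate B t a b : measurable B -> (forall x, B (x + t) <-> B x) ->
  leb_itv B (a + t) (b + t) = leb_itv B a b.
Proof.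
move=> mB Bt; rewrite /leb_itv -(leb_translate t); last exact: measurable_cap_itv.
congr (mu _); apply/seteqP; split=> x; rewrite /translate /= !in_itv /=.
  by rewrite ltrD2r lerD2r Bt.
by rewrite ltrD2r lerD2r Bt.
Qed.

Lemma inv_int B t (k : int) : (forall x, B (x + t) <-> B x) ->
  forall x, B (x + k%:~R * t) <-> B x.
Proof.
move=> Bt x; have Hp n y : B (y + n%:R * t) <-> B y.
  elim: n => [|n IH]; first by rewrite mul0r addr0.
  have -> : y + n.+1%:R * t = y + n%:R * t + t by rewrite -natr1; ring.
  by rewrite Bt.
case: k => n; first exact: Hp.
have -> : x + (Negz n)%:~R * t = x - n.+1%:R * t by rewrite NegzE mulrNz mulNr.
by rewrite -[X in X <-> _](Hp n.+1) subrK.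
Qed.

(** Cutting at the integer in the interval, the two pieces are translates of the
    pieces of the unit interval. *)
Lemma leb_itv_period B a : measurable B -> (forall x, B (x + 1) <-> B x) ->
  leb_itv B a (a + 1) = leb_itv B 0 1.
Proof.
move=> mB B1; pose k := Num.floor a; pose t := a - k%:~R.
have /andP[t0 t1] : 0 <= t < 1.
  by have := floor_itv a; rewrite /t /k intrD => /andP[h1 h2]; apply/andP; split; lra.
have Bk x : B (x + k%:~R) <-> B x by rewrite -(inv_int k B1 x) mulr1.
have -> : leb_itv B a (a + 1) = leb_itv B t (t + 1).
  by rewrite -(leb_itv_translate t (t + 1) mB Bk); congr leb_itv; rewrite /t; ring.
rewrite (@leb_itvD _ _ 1)//; [|lra|lra].
have -> : leb_itv B 1 (t + 1) = leb_itv B 0 t.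
  by rewrite -(leb_itv_translate 0 t mB B1) add0r.
by rewrite addeC -leb_itvD//; lra.
Qed.

Lemma translate_period B a : measurable B -> (forall x, B (x + 1) <-> B x) ->
  leb_itv (translate a B) 0 1 = leb_itv B 0 1.
Proof.
move=> mB B1; rewrite -(leb_itv_period a mB B1) /leb_itv.
rewrite -[RHS](leb_translate a); last exact: measurable_cap_itv.
congr (mu _); apply/seteqP; split=> x; rewrite /translate /= !in_itv /=.
  by move=> [Bx /andP[h1 h2]]; split=> //; apply/andP; split; lra.
by move=> [Bx /andP[h1 h2]]; split=> //; apply/andP; split; lra.
Qed.

(** Any irrational angle would do; for this one the powers of [alpha - 1] make the
    density of the lattice generated by 1 and [alpha] elementary. *)
Definition alpha : R := Num.sqrt 2.

Lemma alpha_sq : alpha ^+ 2 = 2. Proof. by rewrite sqr_sqrtr. Qed.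
Lemma alpha_gt1 : 1 < alpha.
Proof. by have := alpha_sq; have : 0 <= alpha := sqrtr_ge0 _; nra. Qed.
(** The ring of integer combinations of 1 and [alpha] contains the powers of
    [alpha - 1], which tend to 0. *)
Lemma small_lattice_point e : 0 < e ->
  exists m n : int, 0 < m%:~R + n%:~R * alpha < e.
Proof.
move=> e0; have [k ke] : exists k : nat, (alpha - 1) ^+ k < e.
  exists (Num.trunc e^-1).+1.
  have /truncn_itv/andP[_] : 0 <= e^-1 by rewrite invr_ge0 ltW.
  set N := (Num.trunc _).+1 => eN.
  rewrite -[ltRHS]invrK -[ltLHS]invrK ltf_pV2 ?posrE ?invr_gt0 ?exprn_gt0//; last first.
    by have := alpha_gt1; lra.
  rewrite (lt_trans eN)// -exprVn.
  have h2 : 2 <= (alpha - 1)^-1.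
    have -> : (alpha - 1)^-1 = alpha + 1.
      have h : (alpha - 1) * (alpha + 1) = 1 by have := alpha_sq; lra.
      have h' : alpha - 1 != 0 by have := alpha_gt1; lra.
      by apply: (mulfI h'); rewrite h mulfV.
    by have := alpha_gt1; lra.
  apply: (@lt_le_trans _ _ (2 ^+ N)); last by rewrite lerXn2r ?nnegrE//; lra.
  by rewrite -natrX ltr_nat ltn_expl.
suff [m [n mnE]] : exists m n : int, (alpha - 1) ^+ k = m%:~R + n%:~R * alpha.
  exists m, n; rewrite -mnE ke andbT exprn_gt0//; have := alpha_gt1; lra.
elim: k {ke} => [|k [m [n IH]]]; first by exists 1, 0; rewrite expr0 mul0r addr0.
exists (2 * n - m), (m - n); rewrite exprS IH !intrD !mulrNz intrM.
have -> : (2%:~R : R) = alpha ^+ 2 by rewrite alpha_sq.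
by ring.
Qed.

Lemma lattice_dense a e : 0 < e ->
  exists m n : int, a <= m%:~R + n%:~R * alpha < a + e.
Proof.
move=> e0; have [m [n /andP[d0 de]]] := small_lattice_point e0.
set d := _ + _ in d0 de; pose k := Num.ceil (a / d).
exists (k * m), (k * n).
have -> : (k * m)%:~R + (k * n)%:~R * alpha = k%:~R * d by rewrite !intrM /d; ring.
have := real_ceil_itv (num_real (a / d)); rewrite -/k intrB ltr_pdivlMr// ler_pdivrMr//.
by move=> /andP[h1 h2]; apply/andP; split=> //; lra.
Qed.

Lemma additive_linear (f : R -> R) :
  (forall x y, 0 <= x -> 0 <= y -> f (x + y) = f x + f y) ->
  (forall x, 0 <= x -> 0 <= f x) -> forall h, 0 <= h -> f h = f 1 * h.
Proof.
move=> fD f0 h h0.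
have fn n x : 0 <= x -> f (n%:R * x) = n%:R * f x.
  move=> x0; elim: n => [|n IH].
    by rewrite !mul0r; have := fD 0 0 (lexx _) (lexx _); rewrite addr0; lra.
  by rewrite -natr1 !mulrDl !mul1r fD ?IH// mulr_ge0.
have fle x y : 0 <= x -> x <= y -> f x <= f y.
  move=> x0 xy; have -> : y = x + (y - x) by ring.
  by rewrite fD// ?subr_ge0// lerDl f0 ?subr_ge0.
have f10 : 0 <= f 1 := f0 _ ler01.
have key (n : nat) : `|n%:R * (f h - f 1 * h)| <= f 1.
  have nh0 : 0 <= n%:R * h by rewrite mulr_ge0.
  have /andP[h1 h2] := truncn_itv nh0; set k := Num.trunc _ in h1 h2.
  have := fle _ _ (ler0n _ k) h1; have := fle _ _ nh0 (ltW h2).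
  rewrite (fn n)// -[k.+1%:R]mulr1 -[k%:R]mulr1 !fn// => l1 l2.
  have e1 : k%:R * f 1 <= (n%:R * h) * f 1 by rewrite ler_wpM2r.
  have e2 : (n%:R * h) * f 1 <= k.+1%:R * f 1 by rewrite ler_wpM2r// ltW.
  rewrite -[k.+1%:R]natr1 mulrDl mul1r in l1 e2.
  by rewrite ler_norml; apply/andP; split; lra.
apply/eqP; rewrite -subr_eq0; apply/negPn/negP => n0.
have e0 : 0 < `|f h - f 1 * h| by rewrite normr_gt0.
have /andP[_] := truncn_itv (divr_ge0 f10 (ltW e0)); rewrite ltr_pdivrMr//.
rewrite ltNge; apply/negP/negPn; apply: le_trans (key _); rewrite normrM.
by rewrite ger0_norm.
Qed.

Section Ergodic.
Variable B : set (measurableTypeR R).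
Hypotheses (mB : measurable B) (B1 : forall x, B (x + 1) <-> B x).
Hypothesis Ba : forall x, B (x + alpha) <-> B x.

(** A dense group of translations preserves the trace of Lebesgue measure on [B],
    and the measure of an interval is a continuous function of its ends. *)
Lemma leb_itv_const s h : 0 <= h -> leb_itv B s (s + h) = leb_itv B 0 h.
Proof.
move=> h0; have lat (m n : int) a b :
    leb_itv B (a + (m%:~R + n%:~R * alpha)) (b + (m%:~R + n%:~R * alpha)) = leb_itv B a b.
  apply: leb_itv_translate => // x; rewrite addrA (inv_int n Ba).
  by rewrite -[m%:~R]mulr1 (inv_int m B1).
apply/eqP; rewrite eq_le; apply/andP; split; apply/lee_addgt0Pr => e e0.
  have [m [n /andP[d1 d2]]] := lattice_dense (s - e) e0.
  rewrite subrK in d2; set d := m%:~R + n%:~R * alpha in d1 d2.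
  apply: (@le_trans _ _ (leb_itv B d (h + e + d))).
    by apply: leb_itv_le => //; lra.
  rewrite -[d in leb_itv B d]add0r lat (@leb_itvD _ _ h)//; last lra.
  rewrite leeD2l// (le_trans (leb_itv_bound _ _))//; last by rewrite lee_fin; lra.
  by lra.
have [m [n /andP[d1 d2]]] := lattice_dense s e0.
set d := m%:~R + n%:~R * alpha in d1 d2.
rewrite -(lat m n) -/d add0r.
apply: (@le_trans _ _ (leb_itv B s (s + h + e))).
  by apply: leb_itv_le => //; lra.
rewrite (@leb_itvD _ _ (s + h))//; [|lra|lra].
rewrite leeD2l// (le_trans (leb_itv_bound _ _))//; last by rewrite lee_fin; lra.
by lra.
Qed.

Lemma leb_itv_linear a b : a <= b -> leb_itv B a b = (fine (leb_itv B 0 1) * (b - a))%:E.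
Proof.
move=> ab; pose f h := fine (leb_itv B 0 h).
have fE h : 0 <= h -> leb_itv B 0 h = (f h)%:E.
  by move=> h0; rewrite fineK// leb_itv_fin.
have -> : leb_itv B a b = leb_itv B 0 (b - a).
  by rewrite -(leb_itv_const a) ?subr_ge0//; congr leb_itv; ring.
rewrite fE ?subr_ge0//; congr (_%:E).
apply: (additive_linear (f := f)); last by rewrite subr_ge0.
  move=> x y x0 y0; apply: EFin_inj; rewrite EFinD -!fE ?addr_ge0//.
  by rewrite (@leb_itvD _ _ x)// ?lerDl// leb_itv_const.
by move=> x x0; rewrite -lee_fin -fE// measure_ge0.
Qed.

(** The trace of Lebesgue measure on [B] is proportional to Lebesgue measure on
    intervals, hence on all Borel sets; but it vanishes on the complement of [B]. *)
Lemma rotation_ergodic : leb_itv B 0 1 = 0%E \/ leb_itv B 0 1 = 1%E.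
Proof.
have cE : leb_itv B 0 1 = (fine (leb_itv B 0 1))%:E by rewrite fineK// leb_itv_fin.
set c := fine (leb_itv B 0 1) in cE.
have c0 : 0 <= c by rewrite -lee_fin -cE measure_ge0.
have [cz|cz] := eqVneq c 0; [by left; rewrite cE cz|right].
have cp : 0 < c by rewrite lt_neqAle eq_sym cz.
have ci0 : 0 <= c^-1 by rewrite invr_ge0.
pose nu := mscale (NngNum ci0) (mrestr mu mB).
have nu_def X : nu X = ((c^-1)%:E * mu (B `&` X))%E by rewrite setIC.
have nuE A : measurable A -> mu A = nu A.
  apply: (@lebesgue_measure_unique R nu) => _ [[a b]] _ <-.
  apply: (etrans _ (esym (nu_def _))); have [ab|ba] := leP a b.
    rewrite -/(leb_itv B a b) leb_itv_linear// -/c -EFinM mulrA mulVf// mul1r.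
    rewrite lebesgue_measure_itv /= lte_fin; case: ltP => // ba.
    by have -> : b = a; [lra|rewrite subrr].
  rewrite set_itv_ge; last by rewrite bnd_simp -leNgt ltW.
  by rewrite setI0 !measure0 mule0.
have := etrans (nuE _ (measurable_cap_itv 0 1 (measurableC mB))) (nu_def _).
rewrite setIA setICr set0I measure0 mule0.
move=> h; have : mu `]0, 1] = (leb_itv B 0%R 1%R + mu (~` B `&` `]0%R, 1%R]))%E.
  rewrite /leb_itv -measureU; try by apply: measurable_cap_itv => //; exact: measurableC.
    by rewrite -setIUl setUv setTI.
  by rewrite setIACA setICr set0I.
by rewrite h adde0 lebesgue_measure_itv /= lte_fin ltr01 sube0.
Qed.

End Ergodic.

(** The lattice generated by 1 and [alpha] is null, so it has an open
    neighbourhood [U] of measure less than 1/2. The complement of the translates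
    of [U] restricted to the unit interval has measure at least 1/2 per period. *)
Lemma sparse_periodic_set : exists A : set (measurableTypeR R),
  [/\ measurable A, forall x, A (x + 1) <-> A x, (0 < leb_itv A 0 1)%E &
      forall L : nat, exists2 r, 0 < r <= 1 & forall x, 0 < x <= r ->
        forall k : int, (`|k| <= L)%N -> ~ A (x + k%:~R * alpha)].
Proof.
pose D : set R := range (fun mn : int * int => mn.1%:~R + mn.2%:~R * alpha).
have cD : countable D := sub_countable (card_image_le _ _) (countableP _).
have mD : measurable (D : set (measurableTypeR R)).
  by apply: countable_measurable => // x; exact: measurable_set1.
have D0 : mu D = 0%E by exact: countable_lebesgue_measure0.
have e0 : 0 < 1 / 2 :> R by lra.
have [|U [oU DU UDe]] := @lebesgue_regularity_outer R D _ mD _ e0.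
  by apply: (le_lt_trans _ (ltry 0)); rewrite le_eqVlt; apply/orP; left; apply/eqP; exact: D0.
have mU : measurable (U : set (measurableTypeR R)) by exact: open_measurable.
have Ue : (mu U < (1 / 2)%:E)%E.
  rewrite (measureDI _ mU mD) [X in (_ + X)%E](_ : _ = 0%E) ?adde0//.
  apply/eqP; rewrite eq_le measure_ge0 andbT -D0; apply: le_measure; rewrite ?inE//.
  exact: measurableI.
pose W := U `&` `]0, 1] : set (measurableTypeR R).
pose A : set (measurableTypeR R) := ~` \bigcup_(m : int) translate m%:~R W.
have mW : measurable W by apply: measurableI => //; exact: measurable_itv.
have mA : measurable A.
  apply: measurableC; apply: countable_bigcupT_measurable => // m.
  exact: measurable_translate.
exists A; split=> //.
- move=> x; rewrite /A /translate; split=> nA [m _ /= xm]; apply: nA.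
    exists (m - 1) => //=; rewrite intrB.
    by have -> : x + 1 + (m%:~R - 1%:~R) = x + m%:~R by ring.
  exists (m + 1) => //=; rewrite intrD.
  by have -> : x + (m%:~R + 1%:~R) = x + 1 + m%:~R by ring.
- rewrite lt_neqAle measure_ge0 andbT eq_sym; apply/eqP => A0.
  have mI : measurable (`]0%R, 1%R]%classic : set (measurableTypeR R)).
    exact: measurable_itv.
  have := measureDI mu mI mU.
  rewrite [X in _ = (X + _)%E](_ : _ = 0%E); last first.
    apply/eqP; rewrite eq_le measure_ge0 andbT -A0; apply: le_measure.
    - by rewrite inE; exact: measurableD.
    - by rewrite inE; exact: measurable_cap_itv.
    - move=> x [xI nU]; split=> // -[m _ [/= Um]]; rewrite in_itv /= => xm.
      suff m0 : m = 0 by apply: nU; rewrite m0 addr0 in Um.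
      move: xI; rewrite /= in_itv /= => xI.
      have h1 : (m%:~R : R) < 1%:~R by lra.
      have h2 : ((- 1)%:~R : R) < m%:~R by rewrite mulrNz; lra.
      by rewrite !ltr_int in h1 h2; lia.
  rewrite add0e => H.
  have : (mu `]0%R, 1%R] < (1 / 2)%:E)%E.
    rewrite H; apply: le_lt_trans Ue; apply: le_measure; rewrite ?inE//.
    exact: measurableI.
  by rewrite lebesgue_measure_itv /= lte_fin ltr01 sube0 lte_fin; lra.
- have single (k : int) : exists2 r, 0 < r <= 1 & forall x, 0 < x <= r ->
      ~ A (x + k%:~R * alpha).
    pose m := - Num.floor (k%:~R * alpha : R).
    pose z : R := k%:~R * alpha + m%:~R.
    have /andP[z0 z1] : 0 <= z < 1.
      rewrite /z /m mulrNz; have := floor_itv (k%:~R * alpha : R).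
      by rewrite intrD => /andP[h1 h2]; apply/andP; split; lra.
    have Uz : U z by apply: DU; exists (m, k) => //=; rewrite /z addrC.
    have /nbhs_ballP[e /= ep He] : nbhs z U by apply: open_nbhs_nbhs; split.
    exists (Num.min (e / 2) (1 - z)).
      by rewrite lt_min ge_min divr_gt0//= subr_gt0 z1 lerBlDr lerDl z0 orbT.
    move=> x; rewrite le_min => /and3P[x0 xe xz]; apply; exists m => //.
    rewrite /translate /=; have -> : x + k%:~R * alpha + m%:~R = x + z.
      by rewrite /z addrA.
    split; last by rewrite /= in_itv /=; apply/andP; split; lra.
    by apply: He; rewrite /ball /= opprD addrCA subrr addr0 normrN gtr0_norm//; lra.
  elim=> [|L [r /andP[r0 r1] Hr]].
    have [r r01 Hr] := single 0; exists r => // x xr k.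
    by rewrite leqn0 absz_eq0 => /eqP ->; exact: Hr.
  have [s /andP[s0 s1] Hs] := single L.+1%:Z.
  have [t /andP[t0 t1] Ht] := single (- L.+1%:Z).
  exists (Num.min r (Num.min s t)).
    by rewrite !lt_min !ge_min r0 s0 t0 r1.
  move=> x; rewrite !le_min => /and4P[x0 xr xs xt] k.
  rewrite leq_eqVlt => /orP[/eqP kL|]; last by rewrite ltnS; apply: Hr; rewrite x0.
  have [->|->] := absz_eq_or kL.
    by apply: Hs; rewrite x0.
  by apply: Ht; rewrite x0.
Qed.

End Rotation.

(** * Blocked places along a periodic walk *)

Section Region.
Variables (I : finType) (com : rel I) (e : int -> I) (N : nat) (centre : I -> int).
Hypotheses (com_sym : symmetric com) (com_irr : irreflexive com).
Hypothesis e_adj : forall n, (e n != e (n + 1)) && ~~ com (e n) (e (n + 1)).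
Hypothesis e_per : forall n, e (n + N%:Z) = e n.
Hypothesis centreP : forall v, (v != e (centre v)) && (v != e (centre v - 1)).
Hypothesis e_ncom : forall v, exists n, ~~ com (e n) v.

(** The maximal run of integers around [centre v] whose edges have labels
    commuting with [v]. It is the smallest set of places containing [centre v]
    that can be blocked for [v] without destroying the commutations. *)
Definition region v (n : int) : Prop :=
  (forall m, n <= m < centre v -> com (e m) v) /\
  (forall m, centre v <= m < n -> com (e m) v).

Lemma region_centre v : region v (centre v).
Proof. by split=> m /andP[h1 h2]; lia. Qed.

Lemma region_edge v n : com (e n) v -> region v n <-> region v (n + 1).
Proof.
move=> ev; split=> -[h1 h2]; split=> m hm.
- by apply: h1; lia.
- have [->//|mn] := eqVneq m n; apply: h2; lia.
- have [->//|mn] := eqVneq m n; apply: h1; lia.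
- by apply: h2; lia.
Qed.

(** The neighbouring labels commute with [v], or the place is [centre v] itself;
    and an edge labelled [v] cannot follow one whose label commutes with [v]. *)
Lemma region_fix v n : region v n -> (v != e n) && (v != e (n - 1)).
Proof.
have ncom m : com (e m) v -> (v != e m) && (v != e (m + 1)).
  move=> c; apply/andP; split; first by apply: contraTneq c => ->; rewrite com_irr.
  apply: contraTneq c => ->; have := e_adj m.
  by rewrite com_sym => /andP[_].
have ncom' m : com (e m) v -> v != e (m - 1).
  move=> c; apply: contraTneq c => ->; have /andP[_] := e_adj (m - 1).
  by rewrite com_sym subrK.
move=> [h1 h2]; have [lt|gt|->] := ltgtP n (centre v); last exact: centreP.
  have c : com (e n) v by apply: h1; rewrite lexx.
  by rewrite ncom'// andbT; case/andP: (ncom _ c).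
have c : com (e (n - 1)) v by apply: h2; lia.
by have := ncom _ c; rewrite subrK andbC.
Qed.

Lemma region_move v v' n : com v' v -> region v (walk_move e v' n) <-> region v n.
Proof.
move=> c; rewrite /walk_move; case: eqVneq => [v'E|_].
  by rewrite -region_edge// -v'E.
case: eqVneq => [v'E|//].
by rewrite -[n in X in _ <-> X](subrK 1) -region_edge// -v'E.
Qed.

Lemma e_perZ n k : e (n + N%:Z * k) = e n.
Proof.
have ep m (j : nat) : e (m + N%:Z * j%:Z) = e m.
  elim: j => [|j IH]; first by rewrite mulr0 addr0.
  by rewrite -IH -[RHS]e_per; congr e; rewrite intS; ring.
case: k => j; first exact: ep.
by rewrite NegzE -[LHS](ep _ j.+1) mulrN subrK.
Qed.

Lemma walk_move_perZ v n k : walk_move e v (n + N%:Z * k) = walk_move e v n + N%:Z * k.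
Proof.
rewrite /walk_move e_perZ (addrAC n _ (-1)) e_perZ (addrAC n _ 1).
by case: ifP => // _; case: ifP.
Qed.

Hypothesis N0 : (0 < N)%N.

(** By periodicity, labels not commuting with [v] occur on both sides. *)
Lemma region_bounded v : exists L : nat, forall n, region v n -> (`|n| <= L)%N.
Proof.
have [n0 nc] := e_ncom v.
pose a := n0 - N%:Z * (`|n0 - centre v| + 1)%N%:Z.
pose b := n0 + N%:Z * (`|n0 - centre v| + 1)%N%:Z.
have ea : ~~ com (e a) v by rewrite /a -mulrN e_perZ.
have eb : ~~ com (e b) v by rewrite /b e_perZ.
have ac : a < centre v by rewrite /a; nia.
have cb : centre v <= b by rewrite /b; nia.
exists (`|a| + `|b|)%N => n [h1 h2].
have an : a < n.
  by rewrite ltNge; apply: contra ea => na; apply: h1; rewrite na ac.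
have nb : n <= b.
  by rewrite leNgt; apply: contra eb => bn; apply: h2; rewrite cb bn.
clear -an nb; lia.
Qed.

Section Select.
Variables (R : realType) (A : set (measurableTypeR R)).
Hypotheses (mA : measurable A) (A1 : forall x, A (x + 1) <-> A x).

(** In the [k]-th period, the translated regions are blocked for all generators
    together, according to one bit of the rotation. *)
Definition blocked (x : R) (n : int) (v : I) : bool :=
  `[< exists k : int, A (x + k%:~R * alpha R) /\ region v (n - N%:Z * k) >].

Lemma blocked_fix x n v : blocked x n v -> (v != e n) && (v != e (n - 1)).
Proof.
move=> /asboolP[k [_ /region_fix]].
by rewrite addrAC -mulrN !e_perZ.
Qed.

Lemma blocked_com x n v v' : com v' v -> blocked x (walk_move e v' n) v = blocked x n v.
Proof.
move=> c; apply/asboolP/asboolP => -[k [Ak rk]]; exists k; split=> //.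
  by move: rk; rewrite -mulrN -walk_move_perZ => /region_move; apply.
by rewrite -mulrN -walk_move_perZ mulrN; apply/region_move.
Qed.

Lemma blocked_centre x v : A x -> blocked x (centre v) v.
Proof.
move=> Ax; apply/asboolP; exists 0; rewrite mul0r addr0 mulr0 subr0.
by split=> //; exact: region_centre.
Qed.

Lemma blocked_shift x n v m : blocked (x + m%:~R * alpha R) n v = blocked x (n + N%:Z * m) v.
Proof.
apply/asboolP/asboolP => -[k [Ak rk]].
  exists (m + k); split; first by rewrite intrD mulrDl addrA.
  by rewrite (_ : _ - _ = n - N%:Z * k)//; ring.
exists (k - m); split.
  have -> : x + m%:~R * alpha R + (k - m)%:~R * alpha R = x + k%:~R * alpha R.
    by rewrite intrB; ring.
  by [].
by rewrite (_ : _ - _ = n + N%:Z * m - N%:Z * k)//; ring.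
Qed.

Lemma blocked_period x n v : blocked (x + 1) n v = blocked x n v.
Proof.
by apply/asboolP/asboolP => -[k [Ak rk]]; exists k; split=> //;
  move: Ak; rewrite addrAC A1.
Qed.

Lemma measurable_blocked n v : measurable ([set x | blocked x n v] : set (measurableTypeR R)).
Proof.
pose F (k : int) : set (measurableTypeR R) :=
  if `[< region v (n - N%:Z * k) >] then translate (k%:~R * alpha R) A else set0.
rewrite [X in measurable X](_ : _ = \bigcup_k F k).
  apply: countable_bigcupT_measurable => // k; rewrite /F; case: ifP => // _.
  exact: measurable_translate.
apply/seteqP; split=> x.
  move=> /asboolP[k [Ak rk]]; exists k => //; rewrite /F ifT//; exact/asboolP.
move=> [k _]; rewrite /F; case: ifPn => // /asboolP rk Ak; apply/asboolP.
by exists k.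
Qed.

Lemma blocked_none (L : nat) : exists K : nat, forall x,
  (forall k : int, (`|k| <= K)%N -> ~ A (x + k%:~R * alpha R)) ->
  forall n v, (`|n| <= L)%N -> ~~ blocked x n v.
Proof.
have /choice[B HB] := region_bounded.
exists (L + \max_v B v)%N => x Hx n v nL; apply/negP => /asboolP[k [Ak /HB rk]].
apply: Hx Ak; have : (B v <= \max_v B v)%N by exact: leq_bigmax.
move: (\max_v B v) rk => M; move: (B v) => b rk bM.
have : (`|(N%:Z * k)%R| <= L + M)%N by lia.
rewrite abszM /=; apply: leq_trans; by rewrite leq_pmull.
Qed.

End Select.
End Region.

(** * Measurability in the Chabauty space *)

Section Chabauty.
Variables (G : groupType) (en : nat -> G).
Hypothesis en_surj : forall g, exists i, en i = g.

(** The filter of the cylinders around [f] along the enumeration [en] converges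
    pointwise to [f], so it refines the neighbourhoods of [f]. *)
Lemma ptws_nbhs (W : set {ptws G -> bool}) (f : {ptws G -> bool}) : nbhs f W ->
  exists n, forall f' : G -> bool, (forall i, (i < n)%N -> f' (en i) = f (en i)) -> W f'.
Proof.
pose C n : set {ptws G -> bool} := [set f' | forall i, (i < n)%N -> f' (en i) = f (en i)].
pose F : set_system {ptws G -> bool} := filter_from setT C.
have FF : Filter F.
  apply: filter_from_filter; first by exists 0%N.
  move=> i j _ _; exists (maxn i j) => // g Hg.
  by split=> k ki; apply: Hg; rewrite leq_max ki ?orbT.
have : {ptws, F --> f}.
  apply/cvg_sup => g X [V [[Y oY <-] Yf VX]]; have [i ig] := en_surj g.
  by exists i.+1 => // h /(_ i (ltnSn i)); rewrite ig => hg; apply: VX; rewrite /= hg.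
by move=> /[apply] -[n _ Cn]; exists n => f' Hf'; exact: Cn.
Qed.

Lemma SubGrp_nbhs (U : set (SubGrp G)) (H : SubGrp G) : open U -> U H ->
  exists n, forall H', (forall i, (i < n)%N -> in_sub (en i) H' = in_sub (en i) H) -> U H'.
Proof.
move=> [W oW <-] WH.
have [n Hn] := @ptws_nbhs W (set_val H) (open_nbhs_nbhs (conj oW WH)).
by exists n => H' HH'; apply: Hn.
Qed.

(** Since [G] is countable, an open set of subgroups is a countable union of
    cylinders, which are encoded here by sequences of bits. *)
Lemma measurable_SubGrp d (T : measurableType d) (f : T -> borelSubGrp G) :
  (forall g, measurable [set x | in_sub g (f x)]) -> measurable_fun setT f.
Proof.
move=> mf.
apply: (@measurability _ _ T (borelSubGrp G) setT f (@open (SubGrp G))) => //.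
move=> _ [U oU <-]; rewrite setTI.
pose sig (H : borelSubGrp G) n := [seq in_sub (en i) H | i <- iota 0 n].
pose cyl (t : seq bool) : set (borelSubGrp G) := [set H | sig H (size t) = t].
pose F (t : seq bool) : set T := if `[< cyl t `<=` U >] then f @^-1` cyl t else set0.
rewrite [X in measurable X](_ : _ = \bigcup_t F t).
  apply: countable_bigcupT_measurable => // t; rewrite /F; case: ifP => // _.
  rewrite /cyl /sig /preimage /=; elim: t 0%N => [|b t IH] k.
    rewrite [X in measurable X](_ : _ = setT); first exact: measurableT.
    by apply/seteqP; split=> x.
  rewrite [X in measurable X](_ : _ =
    (if b then [set x | in_sub (en k) (f x)] else ~` [set x | in_sub (en k) (f x)])
    `&` [set x | [seq in_sub (en i) (f x) | i <- iota k.+1 (size t)] = t]).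
    apply: measurableI; last exact: IH.
    by case: b => //; exact: measurableC.
  apply/seteqP; split=> x /=; first by case=> <- ?; split=> //; case: ifPn => //= /negP.
  by move=> [h ->]; congr (_ :: _); case: b h => /=; [|move=> /negP/negPf].
apply/seteqP; split=> x.
  move=> /= Ux; have [n Hn] := SubGrp_nbhs oU Ux.
  exists (sig (f x) n) => //; rewrite /F ifT.
    by rewrite /cyl /= /sig size_map size_iota.
  apply/asboolP => H; rewrite /cyl /= /sig size_map size_iota => HE.
  apply: Hn => i ni; move: HE => /(congr1 (nth false ^~ i)).
  by rewrite !(nth_map 0%N) ?size_iota// nth_iota.
by move=> [t _]; rewrite /F; case: ifPn => // /asboolP cU /cU.
Qed.

End Chabauty.

Lemma measurable_in_sub (G : groupType) (g : G) :
  measurable ([set H | in_sub g H] : set (borelSubGrp G)).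
Proof.
apply: sub_sigma_algebra; exists [set f : {ptws G -> bool} | f g] => //.
have H : continuous (fun f : {ptws G -> bool} => f g).
  exact: (@proj_continuous G (fun=> bool) g).
have := iffLR (@continuousP {ptws G -> bool} bool _) H [set true] (discrete_open _).
by congr open; apply/seteqP; split=> f /=.
Qed.

(** * The random stabilizer *)

Section RandomStabilizer.
Variables (R : realType) (G : groupType) (I : finType) (com : rel I) (gen : I -> G).
Hypothesis GP : racg com gen.
Variables (e : int -> I) (N : nat) (centre : I -> int).
Hypothesis e_adj : forall n, (e n != e (n + 1)) && ~~ com (e n) (e (n + 1)).
Hypotheses (N0 : (0 < N)%N) (e_per : forall n, e (n + N%:Z) = e n).
Hypothesis centreP : forall v, (v != e (centre v)) && (v != e (centre v - 1)).
Hypothesis e_ncom : forall v, exists n, ~~ com (e n) v.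
Variable A : set (measurableTypeR R).
Hypotheses (mA : measurable A) (A1 : forall x, A (x + 1) <-> A x).
Hypothesis A0 : (0 < leb_itv A 0 1)%E.
Hypothesis A_sparse : forall L : nat, exists2 r, 0 < r <= 1 & forall x, 0 < x <= r ->
        forall k : int, (`|k| <= L)%N -> ~ A (x + k%:~R * alpha R).

Local Notation blk := (blocked com e N centre A).
Local Notation csym := (com_symm GP).
Local Notation cirr := (com_irrefl GP).

Lemma blk_fix x n v : blk x n v -> (v != e n) && (v != e (n - 1)).
Proof. exact: (blocked_fix csym cirr e_adj e_per centreP). Qed.

Lemma blk_com x n v v' : com v' v -> blk x (walk_move e v' n) v = blk x n v.
Proof. exact: (blocked_com _ e_per). Qed.

Local Notation blocked_stepP x := (blocked_step_action GP e_adj (@blk_fix x) (@blk_com x)).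

Definition rstab (x : measurableTypeR R) (n : int) : SubGrp G :=
  exist _ (stab GP e (blk x) n : {ptws G -> bool})
    (mem_set (stab_subgroup GP e_adj (@blk_fix x) (@blk_com x) n)).

Lemma in_rstab g x n : in_sub g (rstab x n) = stab GP e (blk x) n g.
Proof. by []. Qed.

Lemma SubGrp_ext (H K : SubGrp G) : (forall g, in_sub g H = in_sub g K) -> H = K.
Proof. by move=> HK; apply: val_inj; apply/funext => g; exact: HK. Qed.

Lemma rstab_conj g x n : sub_conj g (rstab x n) = rstab x (group_act GP (walk_move e) g n).
Proof.
apply: SubGrp_ext => h.
exact: (stab_conj GP e_adj (@blk_fix x) (@blk_com x)).
Qed.

Lemma rstab_shift x n m : rstab x (n + N%:Z * m) = rstab (x + m%:~R * alpha R) n.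
Proof.
apply: SubGrp_ext => g; rewrite !in_rstab; symmetry; apply: stab_shift.
  by move=> k; exact: e_perZ.
by move=> k v; exact: blocked_shift.
Qed.

Lemma rstab_period x n : rstab (x + 1) n = rstab x n.
Proof.
have E : blk (x + 1) = blk x.
  by apply/funext => k; apply/funext => v; exact: blocked_period.
by apply: SubGrp_ext => g; rewrite !in_rstab E.
Qed.

(** Each letter acts by an involution, which is one of two fixed maps depending on
    whether the place is blocked; so the last letter can be moved to the target. *)
Lemma measurable_word_act w a0 a :
  measurable ([set x | word_act (blocked_step gen e (blk x)) w a0 = a] : set (measurableTypeR R)).
Proof.
elim: w a => [|v w IH] a.
  have [->|a0a] := pselect (a0 = a).
    by rewrite [X in measurable X](_ : _ = setT)//; apply/seteqP; split.
  by rewrite [X in measurable X](_ : _ = set0)//; apply/seteqP; split.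
pose S : set (measurableTypeR R) := [set x | blk x a.2 v].
have mS : measurable S by exact: measurable_blocked.
pose b : G * int := ((gen v * a.1)%g, walk_move e v a.2).
rewrite [X in measurable X](_ : _ =
  (S `&` [set x | word_act (blocked_step gen e (blk x)) w a0 = a]) `|`
  (~` S `&` [set x | word_act (blocked_step gen e (blk x)) w a0 = b])).
  by apply: measurableU; apply: measurableI => //; exact: measurableC.
apply/seteqP; split=> x /=.
  move=> H; have : word_act (blocked_step gen e (blk x)) w a0 = blocked_step gen e (blk x) v a.
    by rewrite -H; case: (blocked_stepP x) => ->.
  by rewrite /blocked_step; case: ifPn => [s ->|/negP s ->]; [left|right].
have blocked_stepE : blocked_step gen e (blk x) v a = if blk x a.2 v then a else b by [].
case=> -[s ->].
  by rewrite blocked_stepE ifT.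
have -> : b = blocked_step gen e (blk x) v a by rewrite blocked_stepE ifN//; exact/negP.
by case: (blocked_stepP x) => ->.
Qed.

Lemma gen_enum : exists en : nat -> G, forall g, exists i, en i = g.
Proof.
exists (fun i => word_prod gen (odflt [::] (unpickle i))) => g.
have [w <-] := gen_word GP g; exists (pickle w); by rewrite pickleK.
Qed.

Lemma measurable_in_rstab g n :
  measurable ([set x | in_sub g (rstab x n)] : set (measurableTypeR R)).
Proof.
rewrite [X in measurable X](_ : _ =
    [set x | word_act (blocked_step gen e (blk x)) (word GP g) (1%g, n) = (1%g, n)]).
  exact: measurable_word_act.
by apply/seteqP; split=> x; rewrite /= in_rstab /stab => /eqP.
Qed.

Definition rstab_map n : measurableTypeR R -> borelSubGrp G := fun x => rstab x n.

Lemma measurable_rstab n : measurable_fun setT (rstab_map n).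
Proof.
have [en en_surj] := gen_enum; apply: (measurable_SubGrp en_surj) => g.
exact: measurable_in_rstab.
Qed.

HB.instance Definition _ n :=
  isMeasurableFun.Build _ _ _ _ (rstab_map n) (measurable_rstab n).

Definition unit_leb := mrestr (@lebesgue_measure R) (@measurable_itv R `]0, 1]).
HB.instance Definition _ := Measure.on unit_leb.

Lemma unit_leb_setT : unit_leb setT = 1%E.
Proof.
rewrite [LHS](_ : _ = lebesgue_measure (setT `&` `]0, 1])) // setTI.
by rewrite lebesgue_measure_itv /= lte_fin ltr01 sube0.
Qed.

HB.instance Definition _ :=
  @Measure_isProbability.Build _ _ R unit_leb unit_leb_setT.

Definition rstab_sum := msum (fun i : nat => distribution unit_leb (rstab_map i%:Z)) N.
HB.instance Definition _ := Measure.on rstab_sum.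

Lemma inv_period_ge0 : 0 <= N%:R^-1 :> R. Proof. by rewrite invr_ge0. Qed.

Definition irs_law := mscale (NngNum inv_period_ge0) rstab_sum.
HB.instance Definition _ := Measure.on irs_law.

(** The contribution of the position [n], which may be any integer: it depends
    only on [n] modulo the period by [fibre_law_shift]. *)
Definition fibre_law (B : set (borelSubGrp G)) n := leb_itv (rstab_map n @^-1` B) 0 1.

Lemma irs_lawE B : irs_law B = ((N%:R^-1)%:E * \sum_(i < N) fibre_law B i%:Z)%E.
Proof. by []. Qed.

Lemma irs_law_setT : irs_law setT = 1%E.
Proof.
rewrite irs_lawE (eq_bigr (fun=> 1%E)) => [|i _].
  rewrite sumEFin sumr_const card_ord -EFinM mulVf// pnatr_eq0 -lt0n//.
by rewrite /fibre_law /leb_itv preimage_setT setTI lebesgue_measure_itv /= lte_fin ltr01 sube0.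
Qed.

HB.instance Definition _ :=
  @Measure_isProbability.Build _ _ R irs_law irs_law_setT.

Definition irs_prob : probability (borelSubGrp G) R := irs_law.

Lemma measurable_rstab_preimage B n : measurable B -> measurable (rstab_map n @^-1` B).
Proof. by move=> mB; rewrite -[X in measurable X]setTI; exact: measurable_rstab. Qed.

Lemma fibre_law_shift B n m : measurable B -> fibre_law B (n + N%:Z * m) = fibre_law B n.
Proof.
move=> mB; rewrite /fibre_law -[RHS](translate_period (m%:~R * alpha R)).
- by congr leb_itv; apply/seteqP; split=> x; rewrite /translate /rstab_map /= rstab_shift.
- exact: measurable_rstab_preimage.
- by move=> x; rewrite /rstab_map /= rstab_period.
Qed.

Local Notation pos := (group_act GP (walk_move e)).
Local Notation mvP := (walk_move_action GP e_adj).

Lemma pos_perZ g n k : pos g (n + N%:Z * k) = pos g n + N%:Z * k.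
Proof.
rewrite /group_act; elim: (word _ _) => [//|v w IH] /=.
by rewrite IH (walk_move_perZ e_per).
Qed.

Lemma pos_gen v n : pos (gen v) n = walk_move e v n.
Proof. by have := group_act_word_prod GP mvP [:: v] n; rewrite /= mulg1. Qed.

Lemma pos_transitive n : exists g, pos g 0 = n.
Proof.
have up m : exists g, pos g m = m + 1.
  by exists (gen (e m)); rewrite pos_gen /walk_move eqxx.
have down m : exists g, pos g m = m - 1.
  exists (gen (e (m - 1))); rewrite pos_gen /walk_move eqxx.
  have := e_adj (m - 1); rewrite subrK => /andP[/negPf -> _].
  by [].
have trans m m' : (exists g, pos g 0 = m) -> (exists g, pos g m = m') ->
    exists g, pos g 0 = m'.
  by move=> [g gm] [h hm]; exists (h * g)%g; rewrite (group_actM GP mvP) gm.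
case: n => k.
  elim: k => [|k IH]; first by exists 1%g; rewrite (group_act1 GP mvP).
  by apply: (trans _ _ IH); rewrite -addn1 PoszD; exact: up.
elim: k => [|k IH].
  by have [g gE] := down 0; exists g; rewrite gE.
apply: (trans _ _ IH); have [g gE] := down (Negz k); exists g; rewrite gE; lia.
Qed.

(** Conjugation by [g] moves the position [i] to [pos g i]; as [g] commutes with
    the translation by a period, this permutes the positions modulo the period. *)
Theorem irs_law_invariant : is_IRS irs_prob.
Proof.
move=> g B mB.
have fibreE (i : int) : fibre_law (sub_conj g @^-1` B) i = fibre_law B (pos g i).
  by rewrite /fibre_law; congr leb_itv; apply/seteqP; split=> x; rewrite /rstab_map /= rstab_conj.
have Nz0 : N%:Z != 0 by rewrite eqz_nat -lt0n.
have red (n : int) : (`|(n %% N%:Z)%Z| < N)%N.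
  by have := ltz_pmod n (_ : 0 < N%:Z); have := modz_ge0 n Nz0; lia.
pose sg (i : 'I_N) := Ordinal (red (pos g i%:Z)).
have sgE (i : 'I_N) : pos g i%:Z = (sg i)%:Z + N%:Z * (pos g i%:Z %/ N%:Z)%Z.
  rewrite /= gez0_abs ?modz_ge0// addrC mulrC; exact: divz_eq.
have sg_inj : injective sg.
  move=> i j /(congr1 (fun k : 'I_N => (k : nat)%:Z)) ij.
  have /(congr1 (pos g^-1)) : pos g i%:Z =
      pos g (j%:Z + N%:Z * ((pos g i%:Z %/ N%:Z)%Z - (pos g j%:Z %/ N%:Z)%Z)).
    rewrite pos_perZ mulrBr; have hi := sgE i; rewrite ij in hi.
    have arith (a b s p q : int) : a = s + p -> b = s + q -> a = b + (p - q).
      by move=> -> ->; ring.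
    exact: arith hi (sgE j).
  rewrite !(group_actK GP mvP) => /(congr1 (fun n : int => (n %% N%:Z)%Z)).
  rewrite (addrC j%:Z) (mulrC N%:Z) modzMDl !modz_small ?ltz_nat ?ltn_ord// => -[ij']; exact: val_inj.
rewrite [LHS]irs_lawE [RHS]irs_lawE; congr (_ * _)%E.
rewrite [RHS](reindex_inj sg_inj); apply: eq_bigr => i _.
by rewrite fibreE [in LHS]sgE fibre_law_shift.
Qed.

(** For an invariant event all positions contribute the same, by transitivity;
    comparing [0] with [N], the event is invariant under the rotation. *)
Theorem irs_law_ergodic : irs_ergodic irs_prob.
Proof.
move=> B mB inv; have rE n x : B (rstab x n) <-> B (rstab x 0).
  have [g <-] := pos_transitive n; rewrite -rstab_conj.
  by rewrite -[in X in _ <-> X](inv g).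
have E n : fibre_law B n = fibre_law B 0.
  by rewrite /fibre_law; congr leb_itv; apply/seteqP; split=> x; rewrite /rstab_map /= rE.
have H : irs_law B = fibre_law B 0.
  rewrite irs_lawE (eq_bigr (fun=> fibre_law B 0)) => [|i _]; last exact: E.
  rewrite -[fibre_law B 0]fineK; last exact: leb_itv_fin (measurable_rstab_preimage _ mB) _.
  rewrite sumEFin sumr_const card_ord -EFinM -[X in _ * X]mulr_natl mulrA mulVf ?mul1r//.
  by rewrite pnatr_eq0 -lt0n.
suff [h|h] : fibre_law B 0 = 0%E \/ fibre_law B 0 = 1%E; [left|right|]; try exact: etrans H h.
apply: rotation_ergodic.
- exact: measurable_rstab_preimage.
- by move=> x; rewrite /rstab_map /= rstab_period.
- move=> x; rewrite /rstab_map /= -[X in _ <-> X](rE (0 + N%:Z * 1) x).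
  by rewrite rstab_shift mul1r.
Qed.

Lemma irs_law_gt0 B (n : int) : measurable B -> (0 < fibre_law B n)%E -> (0 < irs_law B)%E.
Proof.
move=> mB Bn; have red : (`|(n %% N%:Z)%Z| < N)%N.
  have Nz0 : N%:Z != 0 by rewrite eqz_nat -lt0n.
  by have := ltz_pmod n (_ : 0 < N%:Z); have := modz_ge0 n Nz0; lia.
rewrite irs_lawE mule_gt0// ?lte_fin ?invr_gt0 ?ltr0n//.
rewrite (bigD1 (Ordinal red))//= (@lt_le_trans _ _ (fibre_law B n))//.
rewrite (_ : fibre_law B n = fibre_law B `|(n %% N%:Z)%Z|%N%:Z); last first.
  rewrite -[RHS](fibre_law_shift _ (n %/ N%:Z)%Z mB); congr fibre_law.
  by rewrite gez0_abs ?modz_ge0 ?eqz_nat -?lt0n// addrC mulrC; exact: divz_eq.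
by rewrite leeDl// sume_ge0// => j _; exact: measure_ge0.
Qed.

Lemma rstab_gen x v : A x -> in_sub (gen v) (rstab x (centre v)).
Proof.
move=> Ax; rewrite in_rstab /stab.
have := group_act_word_prod GP (blocked_stepP x) [:: v] (1%g, centre v); rewrite /= mulg1 => ->.
by rewrite /blocked_step /= blocked_centre.
Qed.

(** Whenever [x] lies in [A], the place [centre v] is blocked for [v]. *)
Lemma irs_law_gen v : (0 < irs_law [set H | in_sub (gen v) H])%E.
Proof.
apply: (@irs_law_gt0 _ (centre v)); first exact: measurable_in_sub.
apply: (lt_le_trans A0); apply: le_measure; rewrite ?inE.
- exact: measurable_cap_itv.
- by apply: measurable_cap_itv; apply: measurable_rstab_preimage; exact: measurable_in_sub.
- by move=> x [Ax x01]; split=> //; exact: rstab_gen.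
Qed.

Theorem irs_law_spanning : irs_spanning irs_prob.
Proof.
apply/seteqP; split=> // g _ H [[H1 HM] SH].
have HV x : H x -> H (x^-1)%g by move=> Hx; rewrite -[(x^-1)%g]mul1g; exact: HM.
have [w <-] := gen_word GP g; elim: w => [//|v w IH] /=.
rewrite -[word_prod gen w]invgK; apply: HM; last exact: HV.
by apply: SH; exact: irs_law_gen.
Qed.

Lemma walk_move_dist v n : (`|walk_move e v n| <= `|n| + 1)%N.
Proof. by rewrite /walk_move; case: ifP => _; [lia|case: ifP => _; lia]. Qed.

Lemma word_act_dist w n : (`|word_act (walk_move e) w n| <= `|n| + size w)%N.
Proof.
elim: w => [|v w IH] /=; first by rewrite addn0.
by rewrite (leq_trans (walk_move_dist _ _))// addn1 addnS ltnS.
Qed.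

(** For [x] close to 0 no place is blocked along the path of [g], so that [(1, 0)]
    is sent to a point with first coordinate [g]. *)
Lemma rstab_avoid g : g <> 1%g -> exists2 r, 0 < r <= 1 &
  forall x, 0 < x <= r -> ~~ in_sub g (rstab x 0).
Proof.
move=> g1; set w := word GP g.
have [K HK] := blocked_none centre e_per e_ncom N0 A (size w).
have [r r01 Hr] := A_sparse K; exists r => // x xr.
rewrite in_rstab /stab /group_act -/w word_act_unblocked => [|w' v sz].
  rewrite word_prod_word xpair_eqE negb_and; apply/orP; left; exact/eqP.
apply: HK; first exact: Hr.
by rewrite (leq_trans (word_act_dist _ _))// ltnW.
Qed.

Theorem irs_law_faithful : irs_faithful irs_prob.
Proof.
apply/seteqP; split=> g; last first.
  move=> ->; rewrite /irs_kernel /= [X in irs_law X](_ : _ = setT) ?irs_law_setT//.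
  by apply/seteqP; split=> // H _; have [] := set_valP H.
rewrite /irs_kernel /= => Hg; apply: contrapT => g1.
have [r /andP[r0 r1] Hr] := rstab_avoid g1.
have mg := measurable_in_sub g.
have : (0 < irs_law (~` [set H | in_sub g H]))%E.
  apply: (@irs_law_gt0 _ 0); first exact: measurableC.
  apply: (@lt_le_trans _ _ (leb_itv setT 0 r)).
    by rewrite /leb_itv setTI lebesgue_measure_itv /= lte_fin r0 sube0 lte_fin.
  apply: le_measure; rewrite ?inE.
  - exact: measurable_cap_itv.
  - by apply: measurable_cap_itv; apply: measurable_rstab_preimage; exact: measurableC.
  - move=> x; rewrite setTI /= !in_itv /= => /andP[x0 xr]; split.
      by apply/negP; apply: Hr; rewrite x0.
    by rewrite x0 (le_trans xr).
suff E : irs_law (~` [set H | in_sub g H]) = 0%E by rewrite E ltxx.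
apply: etrans (probability_setC irs_law mg) _.
by rewrite [X in (_ - X)%E](_ : _ = 1%E) ?subee//; exact: Hg.
Qed.

End RandomStabilizer.

(** * Right-angled reflection groups *)

(** The walk has consecutive edges labelled otherwise than by [v], and [v] fixes
    the integer between them, which serves as [centre v]. *)
Theorem racg_irs (R : realType) (G : groupType) (I : finType) (com : rel I)
    (gen : I -> G) (nadj := [rel i j | (i != j) && ~~ com i j]) :
  racg com gen -> I -> (forall i, exists j, nadj i j) ->
  (forall i, exists j k, [/\ j != i, k != i & nadj j k]) ->
  (forall i j, connect nadj i j) ->
  exists mu : probability (borelSubGrp G) R,
    [/\ is_IRS mu, irs_ergodic mu, irs_faithful mu & irs_spanning mu].
Proof.
move=> GP i0 nbr avoid conn.
have [N [e [N0 e_per e_adj e_edge]]] := periodic_walk conn nbr i0.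
have [centre centreP] : {centre : I -> int & forall v, (v != e (centre v)) && (v != e (centre v - 1))}.
  apply: (@choice _ _ (fun v n => (v != e n) && (v != e (n - 1)))) => v.
  have [j [k [jv kv jk]]] := avoid v; have [n [nj nk]] := e_edge _ _ jk.
  by exists (n + 1); rewrite addrK nj nk eq_sym kv eq_sym.
have e_ncom v : exists n, ~~ com (e n) v.
  have [j vj] := nbr v; have [n [nv nj]] := e_edge _ _ vj.
  by exists (n + 1); rewrite nj (com_symm GP); case/andP: vj.
have [A [mA A1 A0 A_sparse]] := sparse_periodic_set R.
exists (irs_prob GP e_adj N0 e_per centreP mA); split.
- exact: irs_law_invariant.
- exact: irs_law_ergodic.
- exact: irs_law_faithful.
- exact: irs_law_spanning.
Qed.

Section ReflectionGroup.
Variables (R : realType) (d : nat) (P : set (hspace R d)).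
Local Notation V := 'cV[R]_d.+1.
Variables (I : finType) (rho : I -> V) (x0 : hspace R d).
Hypothesis rhoE : forall u, facet_normal P u <-> exists i, u = rho i.
Hypothesis rho1 : forall i, lor (rho i) (rho i) = 1.
Hypothesis rho_ra : forall i j, i != j ->
  lor (rho i) (rho j) = 0 \/ lor (rho i) (rho j) <= -1.
Hypothesis rho_x0 : forall i, lor (val x0) (rho i) < 0.

Lemma hisom_ext (g h : hisom R d) : (forall x : V, val g *m x = val h *m x) -> g = h.
Proof.
move=> gh; apply: val_inj; apply/matrixP => i j.
by have := congr1 (fun v : V => v i 0) (gh (delta_mx j 0)); rewrite -!colE !mxE.
Qed.

(** The hyperboloid spans the ambient space: [y + t o] is time-like for large [t]. *)
Lemma eq_on_hspace (M M' : 'M[R]_d.+1) :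
  (forall p : hspace R d, M *m val p = M' *m val p) -> forall x : V, M *m x = M' *m x.
Proof.
move=> MM y; set o := val x0.
pose t := `|lor y y| + 2 * `|lor o y| + 1.
have yn := ler_norm (lor y y); have on := ler_norm (lor o y).
have y0 : 0 <= `|lor y y| := normr_ge0 _; have o0 : 0 <= `|lor o y| := normr_ge0 _.
have oo : lor o o = -1 := lor_hspace x0.
have [||q [k k0 qE]] := @hspace_point _ _ x0 (y + t *: o).
- rewrite (_ : lor _ _ = lor y y + t * (2 * lor o y) - t * t).
    by rewrite /t; nra.
  by rewrite !lorE oo (lorC y o); ring.
- by rewrite -/o !lorE oo /t; lra.
have := MM q; rewrite qE -!scalemxAr => /(scalerI (lt0r_neq0 k0)).
by rewrite !mulmxDr -!scalemxAr (MM x0) => /addIr.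
Qed.

Lemma reflection_gen_exists i : exists g : reflection_group P,
  forall x, val (val g) *m x = reflection (rho i) x.
Proof.
have [g gE] := reflection_isom (rho1 i).
have gP : reflection_group_pred P g.
  apply: mem_set => H [_]; apply; exists (rho i); last by move=> p; exact: gE.
  by apply/rhoE; exists i.
by exists (exist _ g gP).
Qed.

(** Generators need only be compared with reflections on the points of hyperbolic
    space, and words only at one interior point of [P]. *)
Lemma reflection_racg : exists gen : I -> reflection_group P, racg (at_right_angle rho) gen.
Proof.
have /choice[gen genE] := reflection_gen_exists; exists gen.
have [refl2 reflC] := refl_action rho1.
have ext (g h : reflection_group P) :
    (forall x : V, val (val g) *m x = val (val h) *m x) -> g = h.
  by move=> gh; apply: val_inj; exact: hisom_ext.
have mulE (g h : reflection_group P) (x : V) :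
    val (val (g * h)%g) *m x = val (val g) *m (val (val h) *m x).
  by rewrite mulmxA.
have oneE (x : V) : val (val (1%g : reflection_group P)) *m x = x by rewrite mul1mx.
have wE w x : val (val (word_prod gen w)) *m x = word_act (refl_at rho) w x.
  by elim: w => [|i w IH] /=; rewrite ?oneE// mulE IH genE.
have gen2' i : (gen i * gen i = 1)%g.
  by apply: ext => x; rewrite mulE !genE oneE; exact: refl2.
have rel w : word_prod gen w = 1%g -> word_equiv (at_right_angle rho) w [::].
  move=> w1; apply: (fixing_word_trivial rho1 rho_ra rho_x0).
  by rewrite -wE w1 oneE.
split=> //.
- exact: ortho_sym.
- exact: ortho_irr.
- by move=> i j ij; apply: ext => x; rewrite !mulE !genE; exact: reflC.
- move=> g; suff [w wg] : exists w, val (word_prod gen w) = val g.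
    by exists w; exact: val_inj.
  have /set_mem := valP g; move: (val g) => {}g gg.
  apply: (gg [set h | exists w, val (word_prod gen w) = h]); split.
    split=> [|_ _ [w1 <-] [w2 <-]]; first by exists [::].
    exists (w1 ++ rev w2).
    have revE a : word_prod gen (rev a) = (word_prod gen a)^-1%g.
      elim: a => [|i a IH] /=; first by rewrite invg1.
      rewrite rev_cons -cats1 word_prod_cat IH /= mulg1 invgM; congr (_ * _)%g.
      by rewrite -[RHS]mulg1 -(gen2' i) mulgA mulVg mul1g.
    by rewrite word_prod_cat revE.
  move=> h [u /rhoE[i ->] hE]; exists [:: i]; apply: hisom_ext => x.
  rewrite wE /= /refl_at -genE; apply: eq_on_hspace => p.
  by rewrite genE hE.
Qed.

End ReflectionGroup.

Theorem theorem3 (R : realType) (d : nat) (d_ge2 : (2 <= d)%N)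
    (P : set (hspace R d)) (P_compact : compact P) (P_right : right_angled P) :
  exists mu : probability (borelSubGrp (reflection_group P)) R,
    [/\ is_IRS mu, irs_ergodic mu, irs_faithful mu & irs_spanning mu].
Proof.
have [n [rho [x0 [rhoE [rho1 rho_ra rho_x0] [nbr avoid conn]]]]] :=
  right_angled_facets d_ge2 P_compact P_right.
have [gen GP] := reflection_racg rhoE rho1 rho_ra rho_x0.
have nadjE i j : (lor (rho i) (rho j) <= -1) = (i != j) && ~~ at_right_angle rho i j.
  rewrite /at_right_angle; have [->|ij /=] := eqVneq i j; first by rewrite rho1 lerNr; lra.
  by have [->|h] := rho_ra _ _ ij; rewrite ?eqxx; lra.
apply: (racg_irs R GP ord0).
- by move=> i; have [j ij] := nbr i; exists j; rewrite /= -nadjE.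
- move=> i; have [j [k [ji ki jk]]] := avoid i; exists j, k; split=> //.
  by rewrite /= -nadjE.
- by move=> i j; rewrite -(eq_connect (e := [rel i j | lor (rho i) (rho j) <= -1])).
Qed.
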